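(* Let $a\in(0,1)$ and define the linear operator $T_a$ on complex-valued $L^1(\mathbb{R})$ by $T_a[f](y)=\int_{-\infty}^{\infty}\mathsf{sign}(x-ay)\,\phi(y-x)\,f(x)\,\mathrm{d}x$, with $\phi$ the standard Gaussian density. Let $\mathcal{N}_{L^1}(T_a)=\{f\in L^1(\mathbb{R}): T_a[f]=0\}$. Then $\mathcal{N}_{L^1}(T_a)$ is infinite-dimensional. Moreover, $$\mathrm{span}\left\{f_{\mu_n,\frac{a}{1-a},\omega_n} : (\mu_n,\omega_n)\in\mathbb{R}^2,\ \tfrac{1}{\sqrt2}\Big(\tfrac{1-a}{\sqrt a}\mu_n+j\sqrt a\,\omega_n\Big)\text{ is a zero of }\mathrm{erf}\right\}\subseteq\mathcal{N}_{L^1}(T_a),$$ where $f_{\mu,\sigma^2,\omega}(x)=\exp\!\left(-\frac{(x-\mu)^2}{2\sigma^2}\right)e^{jx\omega}$.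
   Context: $j=\sqrt{-1}$. $\mathrm{erf}(z)=\frac{2}{\sqrt\pi}\int_0^z e^{-t^2}\mathrm{d}t$ is the entire error function on $\mathbb{C}$; it has infinitely many complex zeros. *)

(* Defs.v *)
From HB Require Import structures.
From mathcomp Require Import all_boot all_order all_algebra.
From mathcomp Require Import all_classical all_reals all_analysis.
From mathcomp Require Import complex.
Set Implicit Arguments. Unset Strict Implicit. Unset Printing Implicit Defensive.
Import Order.TTheory GRing.Theory Num.Theory.
Import numFieldNormedType.Exports.
Local Open Scope classical_set_scope.
Local Open Scope ring_scope.
Local Open Scope complex_scope.

Section Defs.
Variable R : realType.

Definition lebR : set R -> \bar R := (@lebesgue_measure R).

Definition cexp (w : R[i]) : R[i] :=
  (expR (complex.Re w) * cos (complex.Im w)) +i* (expR (complex.Re w) * sin (complex.Im w)).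

Definition cintegral (D : set R) (f : R -> R[i]) : R[i] :=
  (Rintegral lebR D (fun x => complex.Re (f x))) +i* (Rintegral lebR D (fun x => complex.Im (f x))).

Definition L1 (f : R -> R[i]) : Prop :=
  lebR.-integrable setT (fun x => (complex.Re (f x))%:E) /\
  lebR.-integrable setT (fun x => (complex.Im (f x))%:E).

(* complex error function: erf z = 2/sqrt(pi) * int_{[0,z]} e^{-t^2} dt,
   integral along the segment t = s z, s in [0,1] *)
Definition erf (z : R[i]) : R[i] :=
  ((2 / Num.sqrt pi)%:C * z) *
  cintegral `[0, 1]%classic (fun s => cexp (- (s%:C * z) ^+ 2)).

Definition phi (t : R) : R := expR (- (t ^+ 2) / 2) / Num.sqrt (2 * pi).

Definition T (a : R) (f : R -> R[i]) (y : R) : R[i] :=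
  cintegral setT (fun x => (Num.sg (x - a * y) * phi (y - x))%:C * f x).

Definition nullT (a : R) (f : R -> R[i]) : Prop :=
  L1 f /\ forall y, T a f y = 0.

Definition fgauss (mu sigma2 omega : R) (x : R) : R[i] :=
  (expR (- (x - mu) ^+ 2 / (2 * sigma2)))%:C * cexp (0 +i* (x * omega)).

End Defs.

(* Main.v *)
Require Import Defs.
From HB Require Import structures.
From mathcomp Require Import all_boot all_order all_algebra.
From mathcomp Require Import all_classical all_reals all_analysis.
From mathcomp Require Import measurable_realfun complex.
From mathcomp Require Import ring lra.
Import Order.TTheory GRing.Theory Num.Theory.
Import numFieldNormedType.Exports.
Local Open Scope classical_set_scope.
Local Open Scope ring_scope.
Local Open Scope complex_scope.
Set Implicit Arguments. Unset Strict Implicit. Unset Printing Implicit Defensive.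

(** Completing the square turns [T a (fgauss mu (a / (1 - a)) om) y] into a
    multiple of the integral of sg(u) exp(-(u - w)^2) over the real line, where
    w is the stated affine combination of mu and om. With
    [gauss_prim z] = int_0^z exp(-t^2) dt as a primitive, this integral is
    2 [gauss_prim w], hence vanishes at the zeros of erf.

    Infinite dimension follows from erf having zeros of arbitrarily large real
    part. Along the direction arg z = pi/4, [gauss_prim z] is close to
    sqrt(pi)/2 - exp(-z^2)/(2z), which can be made almost zero at an explicit
    point z0; since the derivative exp(-z^2) is explicit, the simplified Newton
    map z - exp(z0^2) [gauss_prim z] is a contraction near z0. Gaussians with
    distinct means are linearly independent by evaluating at 0, ..., n-1 and
    inverting a Vandermonde matrix. *)

(** The Gaussian of variance a/(1 - a) has precision (1 - a)/a; with the precision 1 of [phi] this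
    adds up to 1/a, and the product is centred at a y + (1 - a) mu + i a om. The offset of this
    centre from the sign change a y does not depend on y, so one zero of erf annihilates the
    transform at every y at once. The centre is complex, but no contour is shifted: truncated
    integrals equal H(c + N) + H(c - N) - 2 H(c) for a primitive H, and the outer terms cancel
    asymptotically because [gauss_prim] is odd. Real parts that are unbounded, rather than a mere
    infinity of zeros, provide distinct means. The Vandermonde nodes then differ already in modulus,
    and the periodicity of exp in om does no harm. On the ray arg z = pi/4, exp(-z^2) has modulus 1.
    Slightly off it, exp(-z^2)/(2z) can balance sqrt(pi)/2, which gives one equation for the modulus
    and one for the phase. *)

Local Notation Re := complex.Re.
Local Notation Im := complex.Im.
Local Notation normc := ComplexField.Normc.normc.

(** * Complex numbers and functions of a real variable *)

Section ComplexAlgebra.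
Context {R : realType}.
Implicit Types z w : R[i].

Lemma complexP z w : Re z = Re w -> Im z = Im w -> z = w.
Proof. by case: z => a b; case: w => c d /= -> ->. Qed.

Lemma ReD z w : Re (z + w) = Re z + Re w. Proof. by case: z; case: w. Qed.
Lemma ImD z w : Im (z + w) = Im z + Im w. Proof. by case: z; case: w. Qed.
Lemma ReN z : Re (- z) = - Re z. Proof. by case: z. Qed.
Lemma ImN z : Im (- z) = - Im z. Proof. by case: z. Qed.
Lemma ReM z w : Re (z * w) = Re z * Re w - Im z * Im w.
Proof. by case: z; case: w. Qed.
Lemma ImM z w : Im (z * w) = Re z * Im w + Im z * Re w.
Proof. by case: z; case: w. Qed.
Lemma ReX2 z : Re (z ^+ 2) = Re z ^+ 2 - Im z ^+ 2.
Proof. by rewrite expr2 ReM -!expr2. Qed.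
Lemma ImX2 z : Im (z ^+ 2) = 2 * (Re z * Im z).
Proof. by rewrite expr2 ImM; ring. Qed.

Definition ReImE := (ReX2, ImX2, ReM, ImM, ReD, ImD, ReN, ImN).

Lemma normc_ge0 z : 0 <= normc z.
Proof. by case: z => a b /=; exact: sqrtr_ge0. Qed.

Lemma sqr_normcE z : normc z ^+ 2 = Re z ^+ 2 + Im z ^+ 2.
Proof. by case: z => a b /=; rewrite sqr_sqrtr // addr_ge0 // sqr_ge0. Qed.

Lemma normc_real (x : R) : normc (x%:C) = `|x|.
Proof. by rewrite /= expr0n addr0 sqrtr_sqr. Qed.

Lemma Re_le_normc z : `|Re z| <= normc z.
Proof.
rewrite -(@ler_pXn2r _ 2) ?nnegrE ?normc_ge0 // sqr_normcE real_normK ?num_real //.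
by rewrite lerDl sqr_ge0.
Qed.

Lemma Im_le_normc z : `|Im z| <= normc z.
Proof.
rewrite -(@ler_pXn2r _ 2) ?nnegrE ?normc_ge0 // sqr_normcE real_normK ?num_real //.
by rewrite lerDr sqr_ge0.
Qed.

Lemma normc_le z : normc z <= `|Re z| + `|Im z|.
Proof.
rewrite -(@ler_pXn2r _ 2) ?nnegrE ?normc_ge0 ?addr_ge0 // sqr_normcE sqrrD.
rewrite !real_normK ?num_real // addrAC lerDl.
by rewrite mulrn_wge0 // mulr_ge0.
Qed.

Lemma normc_eq0 z : (normc z == 0) = (z == 0).
Proof.
apply/eqP/eqP => [|->]; first exact: ComplexField.Normc.eq0_normc.
by rewrite (normc_real 0) normr0.
Qed.

Lemma normc_gt0 z : (0 < normc z) = (z != 0).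
Proof. by rewrite lt_def normc_eq0 normc_ge0 andbT. Qed.

Lemma normcX z n : normc (z ^+ n) = normc z ^+ n.
Proof.
elim: n => [|n IH]; first by rewrite !expr0 (normc_real 1) normr1.
by rewrite !exprS ComplexField.Normc.normcM IH.
Qed.

Lemma normcB z w : normc (z - w) = normc (w - z).
Proof. by rewrite -normcN opprB. Qed.

Lemma cexpD z w : cexp (z + w) = cexp z * cexp w.
Proof.
by apply: complexP; rewrite !ReImE /= ?ReImE expRD ?cosD ?sinD; ring.
Qed.

Lemma cexp0 : cexp (0 : R[i]) = 1.
Proof. by rewrite /cexp /= expR0 cos0 sin0 !mul1r. Qed.

Lemma normc_cexp z : normc (cexp z) = expR (Re z).
Proof.
rewrite /= !exprMn -mulrDr cos2Dsin2 mulr1 sqrtr_sqr ger0_norm // expR_ge0.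
Qed.

Lemma cexp_neq0 z : cexp z != 0.
Proof. by rewrite -normc_gt0 normc_cexp expR_gt0. Qed.

Lemma cexp_real (x : R) : cexp (x%:C) = (expR x)%:C.
Proof. by rewrite /cexp /= cos0 sin0 mulr1 mulr0. Qed.

Lemma cexp_nat z n : cexp (n%:R * z) = cexp z ^+ n.
Proof.
elim: n => [|n IH]; first by rewrite mul0r cexp0 expr0.
by rewrite exprS -IH -cexpD -natr1; congr cexp; ring.
Qed.

End ComplexAlgebra.

Section ComplexCalculus.
Context {R : realType}.
Implicit Types (f g : R -> R[i]) (t x : R) (d e z v : R[i]).

Definition is_cderive f t d :=
  is_derive t 1 (fun x => Re (f x)) (Re d) /\
  is_derive t 1 (fun x => Im (f x)) (Im d).

Lemma is_cderive_eq f t d e : is_cderive f t d -> d = e -> is_cderive f t e.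
Proof. by move=> ? <-. Qed.

Lemma is_cderive_cst z t : is_cderive (fun=> z) t 0.
Proof. by split; exact: is_derive_cst. Qed.

Lemma is_cderive_real t : is_cderive (fun x => x%:C) t 1.
Proof. by split=> /=; [exact: is_derive_id|exact: is_derive_cst]. Qed.

Lemma is_cderiveD f g t d e : is_cderive f t d -> is_cderive g t e ->
  is_cderive (fun x => f x + g x) t (d + e).
Proof.
move=> [fr fi] [gr gi]; split; rewrite ReImE.
  by under eq_fun do rewrite ReImE; exact: is_deriveD.
by under eq_fun do rewrite ReImE; exact: is_deriveD.
Qed.

Lemma is_cderiveM f g t d e : is_cderive f t d -> is_cderive g t e ->
  is_cderive (fun x => f x * g x) t (d * g t + f t * e).
Proof.
move=> [fr fi] [gr gi]; split; rewrite !ReImE.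
  under eq_fun do rewrite ReImE.
  by apply: is_derive_eq; rewrite /= !/(_ *: _) /=; ring.
under eq_fun do rewrite ReImE.
by apply: is_derive_eq; rewrite /= !/(_ *: _) /=; ring.
Qed.

Lemma is_cderiveZ f t d z : is_cderive f t d ->
  is_cderive (fun x => z * f x) t (z * d).
Proof.
move=> fd; apply: is_cderive_eq (is_cderiveM (is_cderive_cst z t) fd) _.
by rewrite mul0r add0r.
Qed.

Lemma is_cderiveN f t d : is_cderive f t d -> is_cderive (fun x => - f x) t (- d).
Proof.
by move=> /(is_cderiveZ (-1)); under eq_fun do rewrite mulN1r; rewrite mulN1r.
Qed.

Lemma is_cderiveX2 f t d : is_cderive f t d ->
  is_cderive (fun x => f x ^+ 2) t (2 * f t * d).
Proof.
move=> fd; under eq_fun do rewrite expr2.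
by apply: is_cderive_eq (is_cderiveM fd fd) _; ring.
Qed.

Lemma is_cderiveV f t d : is_cderive f t d -> f t != 0 ->
  is_cderive (fun x => (f x)^-1) t (- d / f t ^+ 2).
Proof.
move=> [fr fi] f0.
have ReV z : Re z^-1 = Re z / (Re z ^+ 2 + Im z ^+ 2) by case: z.
have ImV z : Im z^-1 = - (Im z / (Re z ^+ 2 + Im z ^+ 2)) by case: z.
have n0 : Re (f t) ^+ 2 + Im (f t) ^+ 2 != 0.
  by rewrite -sqr_normcE sqrf_eq0 normc_eq0.
(* The squared modulus of [f t ^+ 2], by which the claimed derivative divides. *)
have n1 : (Re (f t) ^+ 2 - Im (f t) ^+ 2) ^+ 2 +
    (2 * (Re (f t) * Im (f t))) ^+ 2 != 0.
  rewrite [X in X != 0](_ : _ = (Re (f t) ^+ 2 + Im (f t) ^+ 2) ^+ 2).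
    by rewrite sqrf_eq0.
  by ring.
have dV := is_deriveV (f := fun x => Re (f x) ^+ 2 + Im (f x) ^+ 2) n0.
split; rewrite !(ReImE, ReV, ImV).
  under eq_fun do rewrite ReV.
  apply: is_derive_eq; rewrite /= !/(_ *: _) /=.
  by field; rewrite n0 n1.
under eq_fun do rewrite ImV.
apply: is_derive_eq; rewrite /= !/(_ *: _) /=.
by field; rewrite n0 n1.
Qed.

Lemma is_cderive_cexp f t d : is_cderive f t d ->
  is_cderive (fun x => cexp (f x)) t (d * cexp (f t)).
Proof.
move=> [fr fi]; split; rewrite ReImE /=.
  apply: is_derive_eq; rewrite /= !/(_ *: _) /=; ring.
apply: is_derive_eq; rewrite /= !/(_ *: _) /=; ring.
Qed.

Lemma is_cderive_affine z v t : is_cderive (fun x => z + x%:C * v) t v.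
Proof.
apply: is_cderive_eq.
  apply: is_cderiveD; first exact: is_cderive_cst.
  by apply: is_cderiveM; [exact: is_cderive_real|exact: is_cderive_cst].
by rewrite add0r mul1r mulr0 addr0.
Qed.

(** The mean value theorem is real, so it is applied to Re(conj(e) f) - |e| g with e = f b - f a.
    The derivative of this function is at most |e| (|f'| - g') <= 0, whence |e|^2 <= |e| (g b - g
    a). If e = 0, what remains is that g does not decrease. *)
Lemma normc_mean_value f f' (g g' : R -> R) (a b : R) : a <= b ->
  (forall t, is_cderive f t (f' t)) -> (forall t, is_derive t 1 g (g' t)) ->
  (forall t, a <= t <= b -> normc (f' t) <= g' t) ->
  normc (f b - f a) <= g b - g a.
Proof.
move=> ab df dg leg; pose e := f b - f a.
have [<-|ltab] := eqVneq a b.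
  by rewrite !subrr (normc_real 0) normr0.
pose r := (fun t => Re e * Re (f t) + Im e * Im (f t) - normc e * g t).
have dr t : is_derive t 1 r
    (Re e * Re (f' t) + Im e * Im (f' t) - normc e * g' t).
  have [fr fi] := df t; have gd := dg t.
  by apply: is_derive_eq; rewrite /= !/(_ *: _) /=; ring.
have [||c /andP] := @MVT _ r _ a b _ (fun t _ => dr t).
- by rewrite lt_neqAle ltab.
- by apply: derivable_within_continuous => t _; exact: (@ex_derive _ _ _ _ _ _ _ (dr t)).
rewrite bnd_simp => -[ac cb] rE.
have e2 : normc e ^+ 2 = Re e * Re e + Im e * Im e.
  by rewrite sqr_normcE !expr2.
have : r b - r a <= 0.
  rewrite rE pmulr_lle0; last by rewrite subr_gt0 lt_neqAle ltab.
  rewrite subr_le0; apply: (@le_trans _ _ (normc e * normc (f' c))).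
    have := Re_le_normc (e^* * f' c).
    rewrite ComplexField.Normc.normcM ReM.
    have -> : normc e^* = normc e by case: (e) => u v /=; rewrite sqrrN.
    have -> : Re e^* = Re e by case: (e).
    have -> : Im e^* = - Im e by case: (e).
    by rewrite mulNr opprK => /(le_trans (ler_norm _)).
  by rewrite ler_wpM2l ?normc_ge0 // leg // !ltW.
rewrite /r.
have -> : Re e * Re (f b) + Im e * Im (f b) - normc e * g b -
    (Re e * Re (f a) + Im e * Im (f a) - normc e * g a) =
    normc e * normc e - normc e * (g b - g a).
  by rewrite -expr2 e2 /e !ReImE; ring.
rewrite -mulrBr.
have [-> _|e0] := eqVneq (normc e) 0; last first.
  by rewrite pmulr_rle0 ?subr_le0 // lt_def e0 normc_ge0.
have g0 t : a <= t <= b -> 0 <= g' t.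
  by move=> /leg; apply: le_trans; exact: normc_ge0.
have [||c' c'ab ->] := @MVT _ g _ a b _ (fun t _ => dg t).
- by rewrite lt_neqAle ltab.
- by apply: derivable_within_continuous => t _; exact: (@ex_derive _ _ _ _ _ _ _ (dg t)).
move: c'ab => /andP[]; rewrite bnd_simp => ac' c'b.
by rewrite mulr_ge0 ?subr_ge0 // g0 // !ltW.
Qed.

End ComplexCalculus.

(** * Integration of complex-valued functions *)

(* [lebR] carries the default measurable structure of [R] while the library
   integrates over [measurableTypeR R]: the two have the same measurable sets
   but different displays, hence the detour through the pushforward along the
   identity. *)
Section Display.
Context {R : realType}.
Local Notation mu := (@lebesgue_measure R).

Let id_display : measurableTypeR R -> R := fun x => x.

Let measurable_id_display : measurable_fun [set: measurableTypeR R] id_display.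
Proof. by move=> _ Y mY; rewrite setTI. Qed.

Let lebRE : @lebR R = pushforward mu id_display.
Proof. by []. Qed.

Lemma integrable_lebR (D : set R) (f : R -> R) :
  measurable D -> measurable_fun [set: R] f ->
  mu.-integrable D (EFin \o f) -> (@lebR R).-integrable D (EFin \o f).
Proof.
move=> mD mf fi; rewrite lebRE; apply: integrable_pushforward => //.
exact/measurable_EFinP.
Qed.

Lemma Rintegral_lebR (D : set R) (f : R -> R) :
  measurable D -> measurable_fun [set: R] f ->
  mu.-integrable D (EFin \o f) ->
  Rintegral (@lebR R) D f = \int[mu]_(x in D) f x.
Proof.
move=> mD mf fi; congr fine; apply: (integral_pushforward measurable_id_display) => //.
Qed.

End Display.

Section ComplexIntegral.
Context {R : realType}.
Local Notation mu := (@lebesgue_measure R).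
Implicit Types (f g F : R -> R[i]) (D : set R).

Definition cintegrable D f :=
  mu.-integrable D (EFin \o (fun x => Re (f x))) /\
  mu.-integrable D (EFin \o (fun x => Im (f x))).

Definition cint D f : R[i] :=
  (\int[mu]_(x in D) Re (f x)) +i* (\int[mu]_(x in D) Im (f x)).

Lemma cintegrableD D f g : measurable D -> cintegrable D f -> cintegrable D g ->
  cintegrable D (fun x => f x + g x).
Proof.
move=> mD [fr fi] [gr gi]; split.
  rewrite [X in mu.-integrable _ X](_ : _ =
    (EFin \o (fun x => Re (f x))) \+ (EFin \o (fun x => Re (g x))))%E; last first.
    by apply/funext => x /=; rewrite ReD.
  exact: integrableD.
rewrite [X in mu.-integrable _ X](_ : _ =
  (EFin \o (fun x => Im (f x))) \+ (EFin \o (fun x => Im (g x))))%E; last first.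
  by apply/funext => x /=; rewrite ImD.
exact: integrableD.
Qed.

Lemma integrable_lin D (f g : R -> R) (a b : R) : measurable D ->
  mu.-integrable D (EFin \o f) -> mu.-integrable D (EFin \o g) ->
  mu.-integrable D (EFin \o (fun x => a * f x + b * g x)).
Proof.
move=> mD fi gi.
rewrite [X in mu.-integrable _ X](_ : _ =
  (fun x => a%:E * (EFin \o f) x) \+ (fun x => b%:E * (EFin \o g) x))%E //.
by apply: integrableD => //; apply: integrableZl.
Qed.

Lemma Rintegral_lin D (f g : R -> R) (a b : R) : measurable D ->
  mu.-integrable D (EFin \o f) -> mu.-integrable D (EFin \o g) ->
  \int[mu]_(x in D) (a * f x + b * g x) =
  a * \int[mu]_(x in D) f x + b * \int[mu]_(x in D) g x.
Proof.
move=> mD fi gi; have iZ (h : R -> R) k : mu.-integrable D (EFin \o h) ->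
    mu.-integrable D (EFin \o (fun x => k * h x)).
  by move=> hi; have := integrable_lin k 0 mD hi hi; under eq_fun do rewrite mul0r addr0.
by rewrite RintegralD ?RintegralZl //; exact: iZ.
Qed.

Lemma cintegrableZ D f z : measurable D -> cintegrable D f ->
  cintegrable D (fun x => z * f x).
Proof.
move=> mD [fr fi]; split.
  under eq_fun do rewrite ReM -mulNr.
  exact: integrable_lin.
under eq_fun do rewrite ImM.
exact: integrable_lin.
Qed.

Lemma cintD D f g : measurable D -> cintegrable D f -> cintegrable D g ->
  cint D (fun x => f x + g x) = cint D f + cint D g.
Proof.
move=> mD [fr fi] [gr gi]; apply: complexP; rewrite !ReImE /=.
  by under eq_Rintegral do rewrite ReD; exact: RintegralD.
by under eq_Rintegral do rewrite ImD; exact: RintegralD.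
Qed.

Lemma cintZ D f z : measurable D -> cintegrable D f ->
  cint D (fun x => z * f x) = z * cint D f.
Proof.
move=> mD [fr fi]; apply: complexP; rewrite !ReImE /=.
  under eq_Rintegral do rewrite ReM -mulNr.
  by rewrite Rintegral_lin // mulNr.
by under eq_Rintegral do rewrite ImM; rewrite Rintegral_lin.
Qed.

Definition ccontinuous f :=
  continuous (fun x => Re (f x)) /\ continuous (fun x => Im (f x)).

Lemma is_derive_continuous (f f' : R -> R) :
  (forall t : R, is_derive t 1 f (f' t)) -> continuous f.
Proof.
move=> df t; have dft := df t.
by apply: differentiable_continuous; apply/derivable1_diffP; exact: ex_derive.
Qed.

Lemma is_cderive_continuous f f' : (forall t, is_cderive f t (f' t)) ->
  ccontinuous f.
Proof.
move=> df; split.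
  by apply: is_derive_continuous => t; exact: (df t).1.
by apply: is_derive_continuous => t; exact: (df t).2.
Qed.

Lemma continuous_itv_integrable (f : R -> R) (a b : R) : continuous f ->
  mu.-integrable `[a, b] (EFin \o f).
Proof.
move=> cf; apply: continuous_compact_integrable; first exact: segment_compact.
exact: continuous_subspaceT.
Qed.

Lemma ccontinuous_itv_integrable f (a b : R) : ccontinuous f ->
  cintegrable `[a, b] f.
Proof. by move=> [fr fi]; split; exact: continuous_itv_integrable. Qed.

Lemma Rintegral_FTC (F f : R -> R) (a b : R) : a < b ->
  (forall t : R, is_derive t 1 F (f t)) -> continuous f ->
  \int[mu]_(x in `[a, b]) f x = F b - F a.
Proof.
move=> ab dF cf.
have cF := is_derive_continuous dF.
rewrite /Rintegral (@continuous_FTC2 _ f F) //.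
- exact: continuous_subspaceT.
- split; last 2 first.
  + by apply: cvg_at_right_filter; exact: cF.
  + by apply: cvg_at_left_filter; exact: cF.
  by move=> x _; have dFx := dF x; exact: ex_derive.
- by move=> x _; have dFx := dF x; rewrite derive1E derive_val.
Qed.

Lemma cint_FTC F f (a b : R) : a < b ->
  (forall t, is_cderive F t (f t)) -> ccontinuous f ->
  cint `[a, b] f = F b - F a.
Proof.
move=> ab dF [fr fi]; apply: complexP; rewrite !ReImE /=.
  apply: (Rintegral_FTC (F := fun x => Re (F x))) => // t; exact: (dF t).1.
apply: (Rintegral_FTC (F := fun x => Im (F x))) => // t; exact: (dF t).2.
Qed.

Lemma is_derive_Rintegral (f f' : R -> R -> R) (a b t : R) :
  (forall x s : R, is_derive x 1 (f^~ s) (f' x s)) ->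
  (forall x, continuous (f x)) ->
  (exists K : R, forall x s : R, `|x - t| < 1 -> a <= s <= b -> `|f' x s| <= K) ->
  is_derive t 1 (fun x => \int[mu]_(s in `[a, b]) f x s)
    (\int[mu]_(s in `[a, b]) f' t s).
Proof.
move=> df cf [K fK].
have tt1 : `]t - 1, t + 1[%classic t.
  by rewrite /= in_itv /=; apply/andP; split; lra.
have xt x : `]t - 1, t + 1[%classic x -> `|x - t| < 1.
  by rewrite /= in_itv /= => xt; rewrite ltr_distl.
have i1 x : `]t - 1, t + 1[%classic x -> mu.-integrable `[a, b] (EFin \o f x).
  by move=> _; exact: continuous_itv_integrable.
have i2 x y : `]t - 1, t + 1[%classic x -> `[a, b]%classic y ->
    derivable (f ^~ y) x 1.
  by move=> _ _; have dfx := df x y; exact: ex_derive.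
have i4 : mu.-integrable `[a, b] (EFin \o (fun=> `|K|)).
  by apply: continuous_itv_integrable; exact: cst_continuous.
have dE x y : partial1of2 f x y = f' x y.
  by have dfx := df x y; rewrite partial1of2E derive_val.
have i5 x y : `]t - 1, t + 1[%classic x -> `[a, b]%classic y ->
    `|partial1of2 f x y| <= `|K|.
  move=> /xt xt' yab; rewrite dE.
  by apply: (le_trans (fK _ _ xt' _)); [move: yab; rewrite /= in_itv|exact: ler_norm].
have mab : measurable (`[a, b]%classic : set (measurableTypeR R)).
  exact: measurable_itv.
have dI := derivable_under_integral mab tt1 i1 i2 (fun=> normr_ge0 K) i4 i5.
have vI := differentiation_under_integral mab tt1 i1 i2 (fun=> normr_ge0 K) i4 i5.
rewrite derive1E in vI.
have -> : \int[mu]_(s in `[a, b]) f' t s =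
    \int[mu]_(s in `[a, b]) partial1of2 f t s.
  by apply: eq_Rintegral => s _; rewrite dE.
exact: (DeriveDef dI vI).
Qed.

Lemma is_cderive_cint (f f' : R -> R -> R[i]) (a b t : R) :
  (forall x s, is_cderive (f^~ s) x (f' x s)) ->
  (forall x, ccontinuous (f x)) ->
  (exists K : R, forall x s : R, `|x - t| < 1 -> a <= s <= b -> normc (f' x s) <= K) ->
  is_cderive (fun x => cint `[a, b] (f x)) t (cint `[a, b] (f' t)).
Proof.
move=> df cf [K fK]; split=> /=.
  apply: (is_derive_Rintegral (f := fun x s => Re (f x s))
    (f' := fun x s => Re (f' x s))).
  - by move=> x s; exact: (df x s).1.
  - by move=> x; exact: (cf x).1.
  - exists K => x s xt sab; apply: (le_trans (Re_le_normc _)); exact: fK.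
apply: (is_derive_Rintegral (f := fun x s => Im (f x s))
  (f' := fun x s => Im (f' x s))).
- by move=> x s; exact: (df x s).2.
- by move=> x; exact: (cf x).2.
- exists K => x s xt sab; apply: (le_trans (Im_le_normc _)); exact: fK.
Qed.

Definition cmeasurable f :=
  measurable_fun [set: R] (fun x => Re (f x)) /\
  measurable_fun [set: R] (fun x => Im (f x)).

Lemma cintegralE D f : measurable D -> cmeasurable f -> cintegrable D f ->
  cintegral D f = cint D f.
Proof.
move=> mD [mr mi] [fr fi]; apply: complexP.
  exact: (@Rintegral_lebR _ D (fun x => Re (f x))).
exact: (@Rintegral_lebR _ D (fun x => Im (f x))).
Qed.

Lemma cintegrable_L1 f : cmeasurable f -> cintegrable setT f -> L1 f.
Proof.
move=> [mr mi] [fr fi]; split.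
  exact: (@integrable_lebR _ setT (fun x => Re (f x))).
exact: (@integrable_lebR _ setT (fun x => Im (f x))).
Qed.

Lemma ccontinuous_measurable f : ccontinuous f -> cmeasurable f.
Proof. by move=> [fr fi]; split; exact: continuous_measurable_fun. Qed.

End ComplexIntegral.

(** * The Gaussian primitive *)

Section GaussPrimitive.
Context {R : realType}.
Implicit Types (z v w : R[i]) (t x s : R).

Definition gauss_prim z :=
  z * cint `[0, 1] (fun s => cexp (- (s%:C * z) ^+ 2)).

Lemma is_cderive_gauss v z t :
  is_cderive (fun x => cexp (- (z + x%:C * v) ^+ 2)) t
    (- (2 * (z + t%:C * v) * v) * cexp (- (z + t%:C * v) ^+ 2)).
Proof.
by apply: is_cderive_cexp; apply: is_cderiveN; apply: is_cderiveX2;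
  exact: is_cderive_affine.
Qed.

Lemma is_cderive_gauss0 z t :
  is_cderive (fun x => cexp (- (x%:C * z) ^+ 2)) t
    (- (2 * (t%:C * z) * z) * cexp (- (t%:C * z) ^+ 2)).
Proof.
have := is_cderive_gauss z 0 t; rewrite add0r.
by under eq_fun do rewrite add0r.
Qed.

Lemma ccontinuous_gauss0 z : ccontinuous (fun x => cexp (- (x%:C * z) ^+ 2)).
Proof. exact: is_cderive_continuous (is_cderive_gauss0 z). Qed.

Lemma erf_gauss_prim z : erf z = (2 / Num.sqrt pi)%:C * gauss_prim z.
Proof.
rewrite /erf /gauss_prim mulrA cintegralE //.
  by apply: ccontinuous_measurable; exact: ccontinuous_gauss0.
by apply: ccontinuous_itv_integrable; exact: ccontinuous_gauss0.
Qed.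

Lemma erf_eq0 z : erf z = 0 <-> gauss_prim z = 0.
Proof.
rewrite erf_gauss_prim; split=> [/eqP|->]; last by rewrite mulr0.
rewrite mulf_eq0 => /orP[|/eqP //].
rewrite -normc_eq0 normc_real normr_eq0 mulf_eq0 invr_eq0 sqrtr_eq0.
by rewrite leNgt pi_gt0 (negbTE (lt0r_neq0 _)).
Qed.

Lemma gauss_primN z : gauss_prim (- z) = - gauss_prim z.
Proof.
rewrite /gauss_prim mulNr; congr (- (_ * cint _ _)).
by apply/funext => s; rewrite mulrN sqrrN.
Qed.

Lemma gauss_prim0 : gauss_prim (0 : R[i]) = 0.
Proof. by rewrite /gauss_prim mul0r. Qed.

Lemma normc_cexp_sqr_le (K : R) z : normc z <= K ->
  normc (cexp (- z ^+ 2)) <= expR (K ^+ 2).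
Proof.
move=> zK; rewrite normc_cexp ler_expR.
apply: (le_trans (ler_norm _)); apply: (le_trans (Re_le_normc _)).
rewrite normcN normcX; apply: lerXn2r => //; rewrite nnegrE ?normc_ge0 //.
exact: le_trans (normc_ge0 _) zK.
Qed.

(** Derivatives along all real lines stand in for holomorphy. Differentiating under the integral
    sign gives v times the integral over s in [0, 1] of f + s df/ds, with f the integrand. This is
    the s-derivative of s f, so only the boundary value exp(-zt^2) at s = 1 survives. *)
Lemma is_cderive_gauss_prim v z t :
  is_cderive (fun x => gauss_prim (z + x%:C * v)) t
    (v * cexp (- (z + t%:C * v) ^+ 2)).
Proof.
pose f x s := cexp (- (s%:C * (z + x%:C * v)) ^+ 2).
pose f' x s := - (2 * (s%:C * (z + x%:C * v)) * (s%:C * v)) * f x s.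
have df x s : is_cderive (f^~ s) x (f' x s).
  apply: is_cderive_cexp; apply: is_cderiveN; apply: is_cderiveX2.
  by apply: is_cderiveZ; exact: is_cderive_affine.
have cf x : ccontinuous (f x) by exact: ccontinuous_gauss0.
pose K := normc z + (`|t| + 1) * normc v.
have K_ge0 : 0 <= K by rewrite addr_ge0 ?mulr_ge0 ?addr_ge0 ?normc_ge0.
have bK x s : `|x - t| < 1 -> 0 <= s <= 1 -> normc (f' x s) <=
    2 * K * normc v * expR (K ^+ 2).
  move=> xt /andP[s0 s1].
  have zK : normc (z + x%:C * v) <= K.
    apply: (le_trans (le_normcD _ _)); rewrite lerD2l.
    rewrite ComplexField.Normc.normcM normc_real ler_wpM2r ?normc_ge0 //.
    rewrite -[x](subrK t) addrC (le_trans (ler_normD _ _)) // lerD2l.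
    exact: ltW.
  have sK u c : normc u <= c -> normc (s%:C * u) <= c.
    move=> uc; rewrite ComplexField.Normc.normcM normc_real ger0_norm //.
    by apply: (le_trans _ uc); rewrite ler_piMl ?normc_ge0.
  rewrite /f' ComplexField.Normc.normcM normcN !(ComplexField.Normc.normcM (2 * _)).
  rewrite (ComplexField.Normc.normcM 2).
  have -> : normc (2 : R[i]) = 2.
    by rewrite -[2 : R[i]]/(1 + 1) -(rmorphD (real_complex R)) normc_real ger0_norm.
  rewrite ler_pM ?normc_ge0 ?mulr_ge0 ?normc_ge0 //; last first.
    by apply: normc_cexp_sqr_le; exact: sK.
  rewrite ler_pM ?normc_ge0 ?mulr_ge0 ?normc_ge0 ?sK // ler_wpM2l // sK //.
have dJ := is_cderive_cint df cf (ex_intro _ _ bK).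
have dG := is_cderiveM (is_cderive_affine z v t) dJ.
apply: is_cderive_eq dG _.
set zt := z + t%:C * v.
pose g s := f t s + s%:C * (- (2 * (s%:C * zt) * zt) * f t s).
have dF s : is_cderive (fun s => s%:C * f t s) s (g s).
  apply: is_cderive_eq (is_cderiveM (is_cderive_real s) (is_cderive_gauss0 zt s)) _.
  by rewrite mul1r.
have m01 : measurable (`[0, 1]%classic : set (measurableTypeR R)).
  exact: measurable_itv.
pose h s := s%:C * (s%:C * f t s).
have ch : ccontinuous h.
  apply: is_cderive_continuous => s.
  exact: is_cderiveM (is_cderive_real s) (dF s).
have f'E : f' t = (fun s => (- (2 * zt * v)) * h s).
  by apply/funext => s; rewrite /f' /h -/zt; ring.
have gE : g = (fun s => f t s + (- (2 * zt * zt)) * h s).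
  by apply/funext => s; rewrite /g /h; ring.
have ih := ccontinuous_itv_integrable 0 1 ch.
have iF := ccontinuous_itv_integrable 0 1 (cf t).
have : cint `[0, 1] g = cexp (- zt ^+ 2).
  rewrite (cint_FTC _ dF) //; last first.
    rewrite gE; apply: is_cderive_continuous => s.
    apply: is_cderiveD; first exact: is_cderive_gauss0.
    apply: is_cderiveZ.
    exact: is_cderiveM (is_cderive_real s) (dF s).
  by rewrite /f -/zt mul0r subr0 !mul1r.
rewrite gE cintD //; last exact: cintegrableZ.
rewrite cintZ // => <-.
rewrite f'E cintZ // -/(f t); ring.
Qed.

Lemma gauss_prim_lipschitz (M : R) z w :
  (forall t, 0 <= t <= 1 -> normc (cexp (- (z + t%:C * (w - z)) ^+ 2)) <= M) ->
  normc (gauss_prim w - gauss_prim z) <= normc (w - z) * M.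
Proof.
move=> leM.
have dg (t : R) : is_derive t 1 (fun x : R => (normc (w - z) * M) * x) (normc (w - z) * M).
  by apply: is_derive_eq; rewrite /= !/(_ *: _) /=; ring.
have := normc_mean_value ler01 (is_cderive_gauss_prim (w - z) z) dg.
rewrite mul1r mul0r addr0 mulr1 mulr0 subr0 (addrC z) subrK; apply=> t t01.
by rewrite ComplexField.Normc.normcM ler_wpM2l ?normc_ge0 // leM.
Qed.

End GaussPrimitive.

(** * Integrals against a sign *)

Section SignIntegral.
Context {R : realType}.
Local Notation mu := (@lebesgue_measure R).

Lemma sgr_indic (c x : R) (h : R -> R) :
  Num.sg (x - c) * h x = (h \_ `]c, +oo[) x - (h \_ `]-oo, c[) x.
Proof.
rewrite !patchE !mem_setE !in_itv /= andbT.
have [cx|xc|->] := ltgtP c x.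
- by rewrite gtr0_sg ?subr_gt0 // mul1r subr0.
- by rewrite ltr0_sg ?subr_lt0 // mulN1r sub0r.
- by rewrite subrr sgr0 mul0r subr0.
Qed.

Lemma measurable_restrict_itv (i : interval R) (h : R -> R) :
  measurable_fun [set: R] h -> measurable_fun [set: R] (h \_ [set` i]).
Proof.
by move=> mh; apply/(measurable_restrictT _ _).1 => //; exact: measurable_funTS.
Qed.

Lemma measurable_sgrM (c : R) (h : R -> R) : measurable_fun [set: R] h ->
  measurable_fun [set: R] (fun x => Num.sg (x - c) * h x).
Proof.
move=> mh; under eq_fun do rewrite sgr_indic.
by apply: measurable_funB; exact: measurable_restrict_itv.
Qed.

Lemma integrable_sgrM (c : R) (h : R -> R) :
  mu.-integrable setT (EFin \o h) ->
  mu.-integrable setT (EFin \o (fun x => Num.sg (x - c) * h x)).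
Proof.
move=> ih; apply: (le_integrable _ _ _ ih) => //.
  apply/measurable_EFinP; apply: measurable_sgrM.
  by have /measurable_EFinP := measurable_int mu ih.
move=> x _ /=; rewrite lee_fin normrM ler_piMl // normr_sg.
by case: (x - c == 0).
Qed.

(** Truncated at distance [n.+1] from c, the integral is the expression in the limit hypothesis, by
    the fundamental theorem of calculus on each side of c. Dominated convergence, with [|h|] as
    dominating function, passes to the whole line. *)
Lemma Rintegral_sgrM (c : R) (h H : R -> R) :
  (forall t : R, is_derive t 1 H (h t)) -> continuous h ->
  mu.-integrable setT (EFin \o h) ->
  H (c + n.+1%:R) + H (c - n.+1%:R) - 2 * H c @[n --> \oo] --> 0 ->
  \int[mu]_x (Num.sg (x - c) * h x) = 0.
Proof.
move=> dH ch ih lim0.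
pose A n : set R := `]c, c + n.+1%:R]%classic.
pose B n : set R := `[c - n.+1%:R, c[%classic.
have mh : measurable_fun [set: R] h by exact: continuous_measurable_fun.
have mA n : measurable (A n : set (measurableTypeR R)) by exact: measurable_itv.
have mB n : measurable (B n : set (measurableTypeR R)) by exact: measurable_itv.
have ihS (D : set R) : measurable (D : set (measurableTypeR R)) ->
    mu.-integrable setT (EFin \o h \_ D).
  move=> mD; rewrite -restrict_EFin; apply/(integrable_mkcond _ mD).
  exact: (integrableS measurableT _ _ ih).
pose f n x := (h \_ (A n)) x - (h \_ (B n)) x.
have mf n : measurable_fun [set: R] (EFin \o f n).
  apply/measurable_EFinP; apply: measurable_funB;
    exact: measurable_restrict_itv.
have fE n : (\int[mu]_x (f n x)%:E)%E =
    (H (c + n.+1%:R) + H (c - n.+1%:R) - 2 * H c)%:E.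
  have n0 : 0 < n.+1%:R :> R by rewrite ltr0n.
  rewrite -[LHS]fineK; last first.
    apply: integrable_fin_num => //.
    by rewrite /f; under eq_fun do rewrite EFinB; apply: integrableB => //; exact: ihS.
  rewrite -[fine _]/(\int[mu]_x f n x) RintegralB //; [|exact: ihS..].
  rewrite -!Rintegral_mkcond.
  rewrite Rintegral_itv_bndo_bndc; last exact: (integrableS measurableT _ _ ih).
  rewrite Rintegral_itv_obnd_cbnd; last exact: (integrableS measurableT _ _ ih).
  rewrite !(Rintegral_FTC _ dH ch) ?ltrBlDr ?ltrDl //.
  by congr (_%:E); ring.
have fcvg x : f n x @[n --> \oo] --> Num.sg (x - c) * h x.
  apply: cvg_near_cst; near=> n; rewrite sgr_indic /f !patchE !mem_setE !in_itv /=.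
  have : `|x - c| < n.+1%:R.
    apply: (@lt_trans _ _ (`|x - c| + 1)); first by rewrite ltrDl.
    rewrite -natr1 ltrD2r; near: n; exact: nbhs_infty_gtr.
  rewrite ltr_norml => /andP[cx xc].
  rewrite (_ : x <= c + n.+1%:R = true); last by apply/idP; lra.
  rewrite (_ : c - n.+1%:R <= x = true); last by apply/idP; lra.
  by rewrite andbT.
have lim_int : (\int[mu]_x (f n x)%:E)%E @[n --> \oo] -->
    (\int[mu]_x (Num.sg (x - c) * h x)%:E)%E.
  apply: (@dominated_cvg _ _ _ mu setT measurableT (fun n x => (f n x)%:E)
    (fun x => (Num.sg (x - c) * h x)%:E) (fun x => `|h x|%:E) mf).
  - by move=> x _; apply: cvg_EFin; [exact: nearW|exact: fcvg].
  - by [].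
  - exact: (integrable_norm ih).
  - move=> n x _; rewrite lee_fin /f !patchE !mem_setE !in_itv /=.
    case: ifP => [/andP[cx _]|_].
      by rewrite (ltNge x c) (ltW cx) andbF subr0.
    by case: ifP; rewrite sub0r normrN // normr0.
rewrite /Rintegral; have -> : (\int[mu]_x (Num.sg (x - c) * h x)%:E)%E = 0%E.
  move: lim_int; rewrite (funext fE) => lim_int; apply: (cvg_unique _ lim_int) => //.
  by apply: cvg_EFin; [exact: nearW|exact: lim0].
by [].
Unshelve. all: by end_near. Qed.

End SignIntegral.

(** * The vanishing criterion for complex integrands, and its Gaussian case *)

Section Balanced.
Context {R : realType}.
Implicit Types (f g h : R -> R[i]) (c : R) (z u : R[i]).

Lemma ccontinuousD f g : ccontinuous f -> ccontinuous g -> ccontinuous (f + g).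
Proof.
move=> [fr fi] [gr gi]; split=> x.
  by under eq_fun do rewrite ReD; apply: cvgD; [exact: fr|exact: gr].
by under eq_fun do rewrite ImD; apply: cvgD; [exact: fi|exact: gi].
Qed.

Lemma ccontinuousM f g : ccontinuous f -> ccontinuous g ->
  ccontinuous (fun x => f x * g x).
Proof.
move=> [fr fi] [gr gi]; split=> x.
  under eq_fun do rewrite ReM.
  apply: cvgB; first by apply: cvgM; [exact: fr|exact: gr].
  by apply: cvgM; [exact: fi|exact: gi].
under eq_fun do rewrite ImM.
apply: cvgD; first by apply: cvgM; [exact: fr|exact: gi].
by apply: cvgM; [exact: fi|exact: gr].
Qed.

Lemma ccontinuous_cst z : ccontinuous (fun=> z).
Proof. by split; exact: cst_continuous. Qed.

Lemma cintegrable0 : cintegrable setT (0 : R -> R[i]).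
Proof. by split; apply: integrable0. Qed.

(* Sufficient for the integral of sg(x - c) h(x) to vanish, and stable under
   linear combinations of [h]. *)
Definition balanced c h := exists H : R -> R[i],
  [/\ (forall t, is_cderive H t (h t)), ccontinuous h, cintegrable setT h &
    normc (H (c + n.+1%:R) + H (c - n.+1%:R) - 2 * H c) @[n --> \oo] --> 0].

Lemma cvg_le_norm (a b : nat -> R) : (forall n, `|a n| <= b n) ->
  b n @[n --> \oo] --> 0 -> a n @[n --> \oo] --> 0.
Proof.
move=> ab b0; apply: norm_cvg0; apply: (squeeze_cvgr _ (cvg_cst 0) b0).
by apply: nearW => n; rewrite normr_ge0 ab.
Qed.

Lemma balanced_integral c h : balanced c h ->
  cintegral setT (fun x => (Num.sg (x - c))%:C * h x) = 0.
Proof.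
move=> [H [dH ch [ir ii] lim0]].
have [mr mi] := ccontinuous_measurable ch.
have ReE : (fun x => Re ((Num.sg (x - c))%:C * h x)) =
    (fun x => Num.sg (x - c) * Re (h x)).
  by apply/funext => x; rewrite ReM /= mul0r subr0.
have ImE : (fun x => Im ((Num.sg (x - c))%:C * h x)) =
    (fun x => Num.sg (x - c) * Im (h x)).
  by apply/funext => x; rewrite ImM /= mul0r addr0.
have two_real (z : R[i]) : (Re (2 * z) = 2 * Re z) * (Im (2 * z) = 2 * Im z).
  by split; rewrite -[2 : R[i]]/(1 + 1) mulrDl mul1r !ReImE; ring.
rewrite cintegralE //.
- rewrite /cint ReE ImE.
  rewrite (@Rintegral_sgrM _ c (fun x => Re (h x)) (fun x => Re (H x)) _ ch.1 ir).
  + rewrite (@Rintegral_sgrM _ c (fun x => Im (h x)) (fun x => Im (H x)) _ ch.2 ii) //.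
      by move=> t; exact: (dH t).2.
    apply: (cvg_le_norm _ lim0) => n; apply: le_trans (Im_le_normc _).
    by rewrite !ImD ImN two_real.
  + by move=> t; exact: (dH t).1.
  + apply: (cvg_le_norm _ lim0) => n; apply: le_trans (Re_le_normc _).
    by rewrite !ReD ReN two_real.
- by split; rewrite ?ReE ?ImE; exact: measurable_sgrM.
- by split; rewrite ?ReE ?ImE; exact: integrable_sgrM.
Qed.

Lemma balancedD c f g : balanced c f -> balanced c g -> balanced c (f + g).
Proof.
move=> [F [dF cf fi F0]] [G [dG cg gi G0]].
exists (fun x => F x + G x); split.
- by move=> t; exact: is_cderiveD.
- exact: ccontinuousD.
- exact: cintegrableD.
- pose a K n := normc (K (c + n.+1%:R) + K (c - n.+1%:R) - 2 * K c) : R.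
  have FG0 : a F n + a G n @[n --> \oo] --> 0.
    by rewrite -[X in _ --> X]addr0; exact: cvgD.
  apply: (cvg_le_norm _ FG0) => n; rewrite ger0_norm ?normc_ge0 //.
  apply: le_trans (le_normcD _ _); rewrite le_eqVlt; apply/orP; left; apply/eqP.
  by congr normc; ring.
Qed.

Lemma balancedZ c f z : balanced c f -> balanced c (fun x => z * f x).
Proof.
move=> [F [dF cf fi F0]]; exists (fun x => z * F x); split.
- by move=> t; exact: is_cderiveZ.
- by apply: ccontinuousM => //; exact: ccontinuous_cst.
- exact: cintegrableZ.
- pose a n := normc (F (c + n.+1%:R) + F (c - n.+1%:R) - 2 * F c) : R.
  have zF0 : normc z * a n @[n --> \oo] --> 0.
    by rewrite -[X in _ --> X](mulr0 (normc z)); apply: cvgM F0; exact: cvg_cst.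
  apply: (cvg_le_norm _ zF0) => n; rewrite ger0_norm ?normc_ge0 //=.
  rewrite -ComplexField.Normc.normcM le_eqVlt; apply/orP; left; apply/eqP.
  by congr normc; ring.
Qed.

Lemma balanced0 c : balanced c 0.
Proof.
exists (fun=> 0); split.
- by move=> t; exact: is_cderive_cst.
- exact: ccontinuous_cst.
- exact: cintegrable0.
- rewrite [X in X @ _](_ : _ = (fun=> 0)); first exact: cvg_cst.
  apply/funext => n; rewrite (_ : _ - _ = 0) ?(normc_real 0) ?normr0 //.
  by rewrite mulr0 subr0 addr0.
Qed.

Lemma cintegrable_gauss_dominated h (m s K : R) : s != 0 -> ccontinuous h ->
  (forall x, normc (h x) <= K * expR (- (x - m) ^+ 2 / (s ^+ 2 *+ 2))) ->
  cintegrable setT h.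
Proof.
move=> s0 ch hK.
have K0 : 0 <= K.
  by have := le_trans (normc_ge0 _) (hK m); rewrite pmulr_lge0 ?expR_gt0.
have ip := integrableZl measurableT (K / normal_peak s) (integrable_normal_pdf m s).
have [mr mi] := ccontinuous_measurable ch.
have hp x : normc (h x) <= `|K / normal_peak s * normal_pdf m s x|.
  apply: (le_trans (hK x)); rewrite normal_pdfE // mulrA divfK.
    exact: ler_norm.
  by rewrite gt_eqF // normal_peak_gt0.
split; apply: (le_integrable _ _ _ ip) => //; try exact/measurable_EFinP.
- by move=> x _; rewrite /= lee_fin; exact: le_trans (Re_le_normc _) (hp x).
- by move=> x _; rewrite /= lee_fin; exact: le_trans (Im_le_normc _) (hp x).
Qed.

Lemma ccontinuous_gauss z v : ccontinuous (fun x => cexp (- (z + x%:C * v) ^+ 2)).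
Proof. by apply: is_cderive_continuous => t; exact: is_cderive_gauss. Qed.

Lemma cintegrable_gauss z (v : R) : 0 < v ->
  cintegrable setT (fun x => cexp (- (z + x%:C * v%:C) ^+ 2)).
Proof.
(* Since Re(-(z + x v)^2) = (Im z)^2 - (Re z + x v)^2, the modulus is itself a real Gaussian in x,
   with mean - Re z / v and standard deviation 1/(sqrt 2 v). *)
move=> v0; apply: (@cintegrable_gauss_dominated _ (- Re z / v) (Num.sqrt 2 * v)^-1
    (expR (Im z ^+ 2))).
- by rewrite invr_neq0 // mulf_neq0 ?gt_eqF // sqrtr_gt0.
- exact: ccontinuous_gauss.
move=> x; rewrite normc_cexp -expRD ler_expR !ReImE /= le_eqVlt; apply/orP; left.
apply/eqP; rewrite exprVn exprMn sqr_sqrtr // -mulr_natl.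
by field; rewrite gt_eqF.
Qed.

(** Let u be the argument at x = c, where [gauss_prim] vanishes. Oddness turns the boundary terms
    into gauss_prim(N v + u) - gauss_prim(N v - u), up to the factor 1/v. The segment joining these
    two points keeps the length 2|u| and moves off to the right, where exp(-z^2) is small. *)
Lemma balanced_gauss c z (v : R) : 0 < v -> gauss_prim (z + c%:C * v%:C) = 0 ->
  balanced c (fun x => cexp (- (z + x%:C * v%:C) ^+ 2)).
Proof.
move=> v0 Gu; set u := z + c%:C * v%:C in Gu.
have v0c : v%:C != 0 by rewrite -normc_eq0 normc_real normr_eq0 gt_eqF.
exists (fun x => v%:C^-1 * gauss_prim (z + x%:C * v%:C)); split.
- move=> t; apply: is_cderive_eq (is_cderiveZ _ (is_cderive_gauss_prim _ _ _)) _.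
  by rewrite mulKf.
- exact: ccontinuous_gauss.
- exact: cintegrable_gauss.
pose C := normc v%:C^-1 * (normc (2 * u) *
  expR (1 + 2 * `|Re u| + Im u ^+ 2)).
apply: (@cvg_le_norm _ (fun n => C * expR (- (2 * v)) ^+ n.+1)); last first.
  rewrite -[X in _ --> X](mulr0 C); apply: cvgM; first exact: cvg_cst.
  rewrite (cvg_shiftS (fun n => expR (- (2 * v)) ^+ n)).
  apply: cvg_expr; rewrite ger0_norm ?expR_ge0 // expRN invf_lt1 ?expR_gt0 //.
  by rewrite expR_gt1 mulr_gt0.
move=> n; set N := n.+1%:R; rewrite ger0_norm ?normc_ge0 //.
rewrite -/u Gu !mulr0 subr0 -mulrDr ComplexField.Normc.normcM /C -!mulrA.
rewrite ler_wpM2l ?normc_ge0 //.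
have -> : z + (c + N)%:C * v%:C = (N * v)%:C + u.
  by rewrite /u !rmorphM !rmorphD /=; ring.
have -> : z + (c - N)%:C * v%:C = - ((N * v)%:C - u).
  by rewrite /u !rmorphM !rmorphB /=; ring.
clearbody u; rewrite gauss_primN.
have -> : 2 * u = ((N * v)%:C + u) - ((N * v)%:C - u) by ring.
apply: gauss_prim_lipschitz => t /andP[t0 t1].
rewrite -expRM_natr -expRD normc_cexp ler_expR.
have -> : (N * v)%:C - u + t%:C * ((N * v)%:C + u - ((N * v)%:C - u)) =
    (N * v)%:C + (2 * t - 1)%:C * u.
  by rewrite rmorphB rmorphM rmorph_nat /= rmorph1; ring.
rewrite !ReImE /= !mul0r !subr0 !addr0 add0r.
set r := 2 * t - 1; have r1 : `|r| <= 1 by rewrite ler_norml /r; lra.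
have rp : - `|Re u| <= r * Re u.
  rewrite lerNl -normrN -mulNr (le_trans (ler_norm _)) // normrM normrN.
  by rewrite normrN ler_piMl.
have rq : (r * Im u) ^+ 2 <= Im u ^+ 2.
  rewrite exprMn ler_piMl ?sqr_ge0 //.
  by move: r1; rewrite ler_norml => /andP[]; nra.
(* With X = N v + r Re u, the inequality - X^2 <= 1 - 2 X trades quadratic for linear decay. It is
   the origin of 1 + 2 |Re u| in [C] and of the geometric ratio exp(-2 v). *)
have := sqr_ge0 (N * v + r * Re u - 1).
rewrite sqrrB expr1n mulr1 -mulr_natl => sq.
lra.
Qed.

End Balanced.

(** * Gaussians in the null space *)

Section GaussNull.
Context {R : realType}.
Implicit Types (a c y mu om x : R).

(** Modulation by om amounts to moving the mean to the complex number mu + i s2 om, so the facts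
    about exp(-(z + x v)^2) apply. *)
Lemma fgaussE mu s2 om : 0 < s2 ->
  let r := Num.sqrt (2 * s2) in
  fgauss mu s2 om = (fun x => cexp ((- (s2 * om ^+ 2) / 2) +i* (mu * om)) *
    cexp (- (((- mu / r) +i* (- (s2 * om) / r)) + x%:C * (r^-1)%:C) ^+ 2)).
Proof.
move=> s20 r; apply/funext => x.
have r0 : 0 < r by rewrite sqrtr_gt0 mulr_gt0.
have rE : s2 = r ^+ 2 / 2 by rewrite sqr_sqrtr ?mulr_ge0 ?ltW // mulrC mulKf.
rewrite /fgauss -cexp_real -!cexpD; congr cexp.
clearbody r; subst s2; apply: complexP; rewrite !ReImE /=.
  by field; rewrite gt_eqF.
by field; rewrite gt_eqF.
Qed.

Lemma ccontinuous_fgauss mu s2 om : 0 < s2 -> ccontinuous (fgauss mu s2 om).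
Proof.
move=> s20; rewrite (fgaussE _ _ s20).
apply: ccontinuousM; first exact: ccontinuous_cst.
exact: ccontinuous_gauss.
Qed.

Lemma cintegrable_fgauss mu s2 om : 0 < s2 ->
  cintegrable setT (fgauss mu s2 om).
Proof.
move=> s20; rewrite (fgaussE _ _ s20).
apply: cintegrableZ => //; apply: cintegrable_gauss.
by rewrite invr_gt0 sqrtr_gt0 mulr_gt0.
Qed.

(* Completing the square in x; variance a/(1-a) makes the centre depend on y as
   a y, the point where the sign changes. *)
Lemma phi_fgaussE a mu om y : 0 < a < 1 ->
  let p := Num.sqrt 2 in let q := Num.sqrt a in
  (fun x => (phi (y - x))%:C * fgauss mu (a / (1 - a)) om x) =
  (fun x => ((Num.sqrt (2 * pi))^-1%:C *
      cexp ((((a * y + (1 - a) * mu) ^+ 2 - (a * om) ^+ 2) / (2 * a)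
             - y ^+ 2 / 2 - mu ^+ 2 * (1 - a) / (2 * a)) +i*
            ((a * y + (1 - a) * mu) * om))) *
    cexp (- (((- (a * y + (1 - a) * mu) / (p * q)) +i* (- (a * om) / (p * q))) +
             x%:C * ((p * q)^-1)%:C) ^+ 2)).
Proof.
move=> /andP[a0 a1] p q; apply/funext => x.
have p2 : p ^+ 2 = 2 by rewrite sqr_sqrtr.
have qE : a = q ^+ 2 by rewrite sqr_sqrtr // ltW.
have p0 : p != 0 by rewrite gt_eqF // sqrtr_gt0.
have q0 : q != 0 by rewrite gt_eqF // sqrtr_gt0.
have a1' : 1 - q ^+ 2 != 0 by rewrite -qE gt_eqF // subr_gt0.
rewrite /phi /fgauss rmorphM /= -!cexp_real mulrAC mulrC -mulrA -!cexpD.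
congr (_ * cexp _).
clearbody p q; subst a; apply: complexP; rewrite !ReImE /= -p2.
  by field; rewrite p0 q0 a1'.
by field; rewrite p0 q0.
Qed.

Lemma balanced_phi_fgauss a mu om y : 0 < a < 1 ->
  erf ((1 / Num.sqrt 2)%:C *
    (((1 - a) / Num.sqrt a * mu) +i* (Num.sqrt a * om))) = 0 ->
  balanced (a * y) (fun x => (phi (y - x))%:C * fgauss mu (a / (1 - a)) om x).
Proof.
move=> a01 /erf_eq0 Gz; rewrite (phi_fgaussE _ _ _ a01).
move: (a01) => /andP[a0 a1].
have p0 : 0 < Num.sqrt 2 :> R by rewrite sqrtr_gt0.
have q0 : 0 < Num.sqrt a by rewrite sqrtr_gt0.
apply: balancedZ; apply: balanced_gauss.
  by rewrite invr_gt0 mulr_gt0.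
(* At x = a y the terms in y cancel, and the argument is - ((1 - a) mu + i a om) / sqrt(2 a), minus
   the assumed zero of erf. Oddness removes the sign. *)
rewrite -[X in gauss_prim X]opprK gauss_primN.
rewrite [X in gauss_prim X](_ : _ = (1 / Num.sqrt 2)%:C *
    (((1 - a) / Num.sqrt a * mu) +i* (Num.sqrt a * om))) ?Gz ?oppr0 //.
have qE : a = Num.sqrt a ^+ 2 by rewrite sqr_sqrtr // ltW.
move: (Num.sqrt a) qE q0 => q qE q0; rewrite qE.
by apply: complexP; rewrite !ReImE /=; field; rewrite !gt_eqF.
Qed.

Lemma sum_funE (n : nat) (F : 'I_n -> R -> R[i]) :
  (fun x => \sum_(k < n) F k x) = \sum_(k < n) F k.
Proof. by apply/funext => x; rewrite fct_sumE. Qed.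

Lemma nullT_span (a : R) (n : nat) (mu om : 'I_n -> R) (c : 'I_n -> R[i]) :
  0 < a < 1 ->
  (forall k, erf ((1 / Num.sqrt 2)%:C *
    (((1 - a) / Num.sqrt a * mu k) +i* (Num.sqrt a * om k))) = 0) ->
  nullT a (fun x => \sum_(k < n) c k * fgauss (mu k) (a / (1 - a)) (om k) x).
Proof.
move=> a01 zk; have /andP[a0 a1] := a01.
have s20 : 0 < a / (1 - a) by rewrite divr_gt0 // subr_gt0.
split.
  rewrite sum_funE; apply: cintegrable_L1.
    apply: ccontinuous_measurable; apply: big_ind => //.
    - exact: ccontinuous_cst.
    - exact: ccontinuousD.
    - move=> k _; apply: ccontinuousM; first exact: ccontinuous_cst.
      exact: ccontinuous_fgauss.
  apply: big_ind => //.
  - exact: cintegrable0.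
  - by move=> f g fi gi; exact: cintegrableD.
  - by move=> k _; apply: cintegrableZ => //; exact: cintegrable_fgauss.
move=> y; rewrite /T.
(* Linear combinations are taken inside [balanced]; a single integral is then evaluated for the
   whole sum. *)
pose h k x := c k * ((phi (y - x))%:C * fgauss (mu k) (a / (1 - a)) (om k) x).
rewrite (_ : (fun x => _) = fun x => (Num.sg (x - a * y))%:C * (\sum_(k < n) h k) x).
  apply: balanced_integral; apply: big_ind => //.
  - exact: balanced0.
  - exact: balancedD.
  - by move=> k _; apply: balancedZ; exact: balanced_phi_fgauss.
apply/funext => x; rewrite fct_sumE rmorphM /= -mulrA; congr (_ * _).
by rewrite mulr_sumr; apply: eq_bigr => k _; rewrite /h; ring.
Qed.

End GaussNull.

(** * Zeros of the Gaussian primitive *)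

Section Newton.
Context {R : realType}.
Implicit Types (z w : R[i]) (u v : 'rV[R]_2).

Let toC u : R[i] := u 0 0 +i* u 0 1.
Let ofC z : 'rV[R]_2 := \row_(i < 2) (if i == 0 then Re z else Im z).

Let ofCK z : toC (ofC z) = z.
Proof. by case: z => a b; rewrite /toC /ofC !mxE. Qed.

Let normc_toC u : normc (toC u) <= 2 * `|u|.
Proof.
apply: (le_trans (normc_le _)); rewrite mulr_natl mulr2n.
have le_u i : `|u 0 i| <= `|u|.
  rewrite [leRHS]/Num.Def.normr /= mx_normrE.
  by apply: le_trans; last exact: (le_bigmax _ _ (0, i)).
by apply: lerD; exact: le_u.
Qed.

Let norm_ofC z : `|ofC z| <= normc z.
Proof.
rewrite [leLHS]/Num.Def.normr /= mx_normrE.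
apply/bigmax_leP; split=> [|[i j] _ /=]; first exact: normc_ge0.
by rewrite mxE; case: ifP => _; [exact: Re_le_normc|exact: Im_le_normc].
Qed.

(** The constants allow for the passage between the modulus and the sup norm of ['rV[R]_2], in which
    Banach's theorem is applied: the modulus is at most twice the sup norm. The sup-norm ball of
    radius r thus lies in the disc of radius 2 r, the Lipschitz constant 1/4 becomes 1/2, and 2 r /
    4 + r / 2 = r makes the ball stable. *)
Lemma gauss_prim_newton z0 (r : R) : 0 < r ->
  (forall z, normc (z - z0) <= 2 * r ->
     normc (1 - cexp (z0 ^+ 2) * cexp (- z ^+ 2)) <= 4^-1) ->
  normc (cexp (z0 ^+ 2) * gauss_prim z0) <= r / 2 ->
  exists2 z, normc (z - z0) <= 2 * r & gauss_prim z = 0.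
Proof.
move=> r0 near1 small.
set E := cexp (z0 ^+ 2) in near1 small.
pose Phi z := z - E * gauss_prim z.
have lipPhi z w : normc (z - z0) <= 2 * r -> normc (w - z0) <= 2 * r ->
    normc (Phi w - Phi z) <= 4^-1 * normc (w - z).
  move=> zr wr; set v := w - z.
  have dg (t : R) : is_derive t 1 (fun x : R => (normc v * 4^-1) * x) (normc v * 4^-1).
    by apply: is_derive_eq; rewrite /= !/(_ *: _) /=; ring.
  have dPhi t : is_cderive (fun x => Phi (z + x%:C * v)) t
      (v * (1 - E * cexp (- (z + t%:C * v) ^+ 2))).
    apply: is_cderive_eq (is_cderiveD (is_cderive_affine z v t)
      (is_cderiveN (is_cderiveZ E (is_cderive_gauss_prim v z t)))) _.
    by ring.
  have zv : z + v = w by rewrite /v addrC subrK.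
  have := normc_mean_value ler01 dPhi dg.
  rewrite mul1r mul0r addr0 mulr1 mulr0 subr0 zv (mulrC (4^-1)).
  apply=> t /andP[t0 t1].
  rewrite ComplexField.Normc.normcM ler_wpM2l ?normc_ge0 //; apply: near1.
  have -> : z + t%:C * v - z0 = (1 - t)%:C * (z - z0) + t%:C * (w - z0).
    by rewrite rmorphB rmorph1 /v; ring.
  apply: (le_trans (le_normcD _ _)); rewrite !ComplexField.Normc.normcM !normc_real.
  rewrite !ger0_norm ?subr_ge0 //.
  have := ler_wpM2l t0 wr; have := @ler_wpM2l _ (1 - t) _ _ _ zr.
  by rewrite subr_ge0 t1 => /(_ isT); lra.
pose u0 := ofC z0; pose U := [set u : 'rV[R]_2 | `|u0 - u| <= r].
have UC u : U u -> normc (toC u - z0) <= 2 * r.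
  move=> Uu; rewrite -[z0]ofCK -/u0.
  have -> : toC u - toC u0 = toC (u - u0) by rewrite /toC !mxE.
  apply: (le_trans (normc_toC _)); rewrite ler_wpM2l //.
  by rewrite distrC.
pose f u := ofC (Phi (toC u)).
have ofCB z w : ofC z - ofC w = ofC (z - w).
  by apply/rowP => i; rewrite !mxE; case: ifP; rewrite !ReImE.
have fU u : U u -> U (f u).
  move=> /UC Uu; rewrite /U /= /f /u0 ofCB; apply: (le_trans (norm_ofC _)).
  have -> : z0 - Phi (toC u) = - (Phi (toC u) - Phi z0) + E * gauss_prim z0.
    by rewrite /Phi; ring.
  apply: (le_trans (le_normcD _ _)); rewrite normcN.
  have : normc (z0 - z0) <= 2 * r.
    by rewrite subrr (normc_real 0) normr0 mulr_ge0 ?ltW.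
  by move=> /lipPhi /(_ Uu); lra.
pose fm := isFun.Build _ _ U U f fU.
pose F : {fun U >-> U} := HB.pack f fm.
have ctrF : is_contraction F.
  exists (2^-1)%:nng; split => /=; first by rewrite invf_lt1 // ltr1n.
  move=> [u v] [/= /UC Uu /UC Uv].
  rewrite /f ofCB; apply: (le_trans (norm_ofC _)).
  apply: (le_trans (lipPhi _ _ Uv Uu)).
  have -> : toC u - toC v = toC (u - v) by rewrite /toC !mxE.
  by have := normc_toC (u - v); lra.
have clU : closed U.
  rewrite [X in closed X](_ : U = closed_ball u0 r).
    exact: closed_ball_closed.
  by rewrite closed_ballE.
have U0 : U !=set0 by exists u0; rewrite /U /= subrr normr0 ltW.
(* The library has no canonical complete normed module structure on matrices. *)
pose X : completeNormedModType R := HB.pack_for (completeNormedModType R)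
  'rV[R]_2 (NormedModule.on 'rV[R]_2) (Complete.on 'rV[R]_2).
have [p Up pE] := @banach_fixed_point R X U F ctrF clU U0.
exists (toC p); first exact: UC.
have : toC p = Phi (toC p) by rewrite {1}pE /= /f ofCK.
rewrite /Phi => /eqP; rewrite eq_sym -subr_eq0 addrAC subrr add0r oppr_eq0.
by rewrite mulf_eq0 (negbTE (cexp_neq0 _)) => /eqP.
Qed.

End Newton.

(** * Asymptotics of the Gaussian primitive and an approximate zero near the diagonal *)

Section Asymptotics.
Context {R : realType}.
Implicit Types (z w : R[i]) (x y : R).

Lemma normc_nat (n : nat) : normc (n%:R : R[i]) = n%:R.
Proof. by rewrite -(rmorph_nat (real_complex R)) normc_real ger0_norm. Qed.

Lemma normc_1Bcexp (M : R) w :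
  (forall t, 0 <= t <= 1 -> expR (t * Re w) <= M) ->
  normc (1 - cexp w) <= normc w * M.
Proof.
move=> wM.
have dg (t : R) : is_derive t 1 (fun x : R => (normc w * M) * x) (normc w * M).
  by apply: is_derive_eq; rewrite /= !/(_ *: _) /=; ring.
have dw t : is_cderive (fun x => cexp (0 + x%:C * w)) t (w * cexp (0 + t%:C * w)).
  by apply: is_cderive_cexp; exact: is_cderive_affine.
have := normc_mean_value ler01 dw dg.
rewrite mul1r mul0r !add0r cexp0 mulr1 mulr0 subr0 normcB; apply=> t /wM t01.
rewrite ComplexField.Normc.normcM ler_wpM2l ?normc_ge0 //.
by rewrite add0r normc_cexp !ReImE /= mul0r subr0.
Qed.

Lemma gauss_prim_real x : 0 < x ->
  gauss_prim x%:C = (gauss_integral_proof.integral0_gauss x)%:C.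
Proof.
move=> x0.
have := cint_FTC x0 (is_cderive_gauss_prim 1 0).
rewrite mul0r addr0 gauss_prim0 subr0 add0r mulr1 => <-; last first.
  apply: is_cderive_continuous => t; apply: is_cderiveZ; exact: is_cderive_gauss.
have fE t : 1 * cexp (- (0 + t%:C * 1) ^+ 2) = (gauss_fun t)%:C :> R[i].
  by rewrite mul1r add0r mulr1 -rmorphXn -rmorphN /= cexp_real.
rewrite /cint; under eq_Rintegral do rewrite fE /=.
congr (_ +i* _); under eq_Rintegral do rewrite fE /=.
by rewrite Rintegral_cst //= mul0r.
Qed.

Lemma cvg_gauss_prim_real (e : R) : 0 < e ->
  exists A : R, forall x, A <= x ->
    normc (gauss_prim x%:C - (Num.sqrt pi / 2)%:C) <= e.
Proof.
move=> e0; pose I := @gauss_integral_proof.integral0_gauss R.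
(* The limit comes as the square root of the limit pi/4 of the squared integral, the integral being
   nonnegative. *)
have cI : I x @[x --> +oo] --> Num.sqrt pi / 2.
  have -> : Num.sqrt pi / 2 = Num.sqrt (pi / 4) :> R.
    rewrite sqrtrM ?pi_ge0 // sqrtrV // (_ : 4 = 2 ^+ 2); last by ring.
    by rewrite sqrtr_sqr ger0_norm.
  rewrite (_ : I = fun x => Num.sqrt (I x ^+ 2)); last first.
    apply/funext => x; rewrite sqrtr_sqr ger0_norm //.
    exact: gauss_integral_proof.integral0_gauss_ge0.
  apply: continuous_cvg; first exact: sqrt_continuous.
  exact: gauss_integral_proof.cvg_integral0_gauss_sqr.
move/cvgrPdist_le : cI => /(_ e e0) [A [_ IA]].
exists (Num.max A 0 + 1) => x Ax.
have x0 : 0 < x by apply: lt_le_trans Ax; rewrite ltr_wpDl // le_max lexx orbT.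
rewrite gauss_prim_real // -rmorphB normc_real distrC; apply: IA.
by apply: lt_le_trans Ax; rewrite (@le_lt_trans _ _ (Num.max A 0)) ?le_max ?lexx // ltrDl.
Qed.

(* The first term of the asymptotic expansion of the complementary error
   function, so that this is close to sqrt(pi)/2; its derivative is
   - exp(-z^2) / (2 z^2). *)
Definition gauss_corr z := gauss_prim z + cexp (- z ^+ 2) / (2 * z).

Lemma gauss_corr_vertical x y : 0 < x -> 0 < y ->
  normc (gauss_corr (x +i* y) - gauss_corr x%:C) <=
    expR (y ^+ 2 - x ^+ 2) / (2 * x ^+ 2 * y).
Proof.
move=> x0 y0; pose zt (t : R) : R[i] := x%:C + t%:C * 'i.
have ztE t : zt t = x +i* t.
  by apply: complexP; rewrite /zt !ReImE /= ?mulr0 ?mulr1 ?mul0r; ring.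
have zt0 t : zt t != 0.
  by rewrite ztE eq_complex /= gt_eqF.
have zt20 t : 2 * zt t != 0.
  by rewrite mulf_neq0 // -normc_eq0 normc_nat pnatr_eq0.
have dF t : is_cderive (fun s => gauss_corr (zt s)) t
    (- 'i * cexp (- zt t ^+ 2) / (2 * zt t ^+ 2)).
  apply: is_cderive_eq.
    apply: is_cderiveD; first exact: is_cderive_gauss_prim.
    apply: is_cderiveM; first exact: is_cderive_gauss.
    apply: is_cderiveV; last exact: zt20.
    apply: is_cderiveZ; exact: is_cderive_affine.
  rewrite -/(zt t); cbv beta; field.
  exact: zt0.
(* On 0 <= t <= y the bound t^2 <= t y replaces exp(t^2) by a function with an elementary primitive,
   and |zt t| >= x bounds the denominator. *)
pose g (t : R) := expR (t * y - x ^+ 2) / (2 * x ^+ 2 * y).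
have dg (t : R) : is_derive t 1 g (expR (t * y - x ^+ 2) / (2 * x ^+ 2)).
  apply: is_derive_eq; rewrite /= !/(_ *: _) /=.
  by field; rewrite !gt_eqF.
have := normc_mean_value (ltW y0) dF dg.
rewrite ztE ztE complexr0 => le_g; apply: le_trans.
  apply: le_g => t /andP[t0 ty].
  rewrite !ComplexField.Normc.normcM ComplexField.Normc.normcV normcN.
  rewrite ComplexField.Normc.normcM normcX normc_nat.
  have -> : normc ('i : R[i]) = 1 by rewrite /= expr0n expr1n add0r sqrtr1.
  rewrite mul1r normc_cexp sqr_normcE ztE /=.
  rewrite ler_pM ?expR_ge0 ?invr_ge0 ?mulr_ge0 ?addr_ge0 ?sqr_ge0 //.
    by rewrite ler_expR; have := ler_wpM2l t0 ty; lra.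
  rewrite lef_pV2 ?posrE ?mulr_gt0 ?exprn_gt0 //.
    by rewrite ler_wpM2l // lerDl sqr_ge0.
  by rewrite ltr_pwDl ?exprn_gt0 ?sqr_ge0.
rewrite /g -expr2 mul0r gerBl divr_ge0 ?expR_ge0 //.
by rewrite !mulr_ge0 // ltW.
Qed.

Lemma normc_ge_sqr (c : R) z : 0 <= c -> c ^+ 2 <= Re z ^+ 2 + Im z ^+ 2 ->
  c <= normc z.
Proof.
by move=> c0; rewrite -sqr_normcE ler_pXn2r // nnegrE normc_ge0.
Qed.

Lemma normc_le_sqr (c : R) z : 0 <= c -> Re z ^+ 2 + Im z ^+ 2 <= c ^+ 2 ->
  normc z <= c.
Proof.
by move=> c0; rewrite -sqr_normcE ler_pXn2r // nnegrE normc_ge0.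
Qed.

Lemma sqrt_2pi_bounds :
  [/\ 2 <= Num.sqrt (2 * pi) :> R, Num.sqrt (2 * pi) <= 3 :> R,
      Num.sqrt pi <= 2 :> R & Num.sqrt (2 * pi) = Num.sqrt 2 * Num.sqrt pi :> R].
Proof.
have pi2 := pi_ge2 R; have pi4 : pi <= 4 :> R.
  have [/andP[_ h] _] := @pihalf_02_cos_pihalf R; lra.
have le_sqrt (x c : R) : 0 <= c -> x <= c ^+ 2 -> Num.sqrt x <= c.
  by move=> c0 xc; rewrite -(ger0_norm c0) -sqrtr_sqr ler_wsqrtr.
split.
- by rewrite -[2 in X in X <= _]ger0_norm // -sqrtr_sqr ler_wsqrtr //; nra.
- by apply: le_sqrt => //; nra.
- by apply: le_sqrt => //; nra.
- by rewrite sqrtrM.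
Qed.

(* [s - eta + i (s + eta)] is an approximate solution of
   exp(-z^2) = sqrt(pi) z, the leading-order form of erf z = 0: its square has
   real part - 4 s eta and imaginary part close to 2 s^2. *)
Lemma gauss_prim_zero_near (s eta : R) : 100 <= s -> 0 < eta <= 400^-1 ->
  expR (4 * s * eta) = Num.sqrt (2 * pi) * s ->
  cexp (0 +i* (- (2 * s ^+ 2))) = ((Num.sqrt 2)^-1)%:C * (1 +i* 1) ->
  normc (gauss_corr (s - eta)%:C - (Num.sqrt pi / 2)%:C) <= 300^-1 ->
  exists2 z : R[i], s - 2 <= Re z & gauss_prim z = 0.
Proof.
move=> s100 /andP[eta0 eta1] es cs near_real.
have [P2 P3 sqrtpi2 PE] := sqrt_2pi_bounds.
have s0 : 0 < s by lra.
set P := Num.sqrt (2 * pi) in es P2 P3 PE.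
pose z0 : R[i] := (s - eta) +i* (s + eta).
(* The phase error of exp(-z0^2): the imaginary part of z0^2 is 2 s^2 - 2 eta^2, whereas the phase
   hypothesis only fixes 2 s^2. *)
pose W : R[i] := cexp (0 +i* (2 * eta ^+ 2)).
have sqrt2_gt0 : 0 < Num.sqrt 2 :> R by rewrite sqrtr_gt0.
have sqrt2_sqr : Num.sqrt 2 ^+ 2 = 2 :> R by rewrite sqr_sqrtr.
have z0_ge : Num.sqrt 2 * s <= normc z0.
  apply: normc_ge_sqr; first by rewrite mulr_ge0 ?ltW.
  by rewrite exprMn sqrt2_sqr /=; nra.
have z0_le : normc z0 <= 2 * s.
  by apply: normc_le_sqr; rewrite ?mulr_ge0 ?ltW //=; nra.
have z00 : z0 != 0.
  by rewrite -normc_gt0 (lt_le_trans _ z0_ge) ?mulr_gt0.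
have e1 : cexp (- z0 ^+ 2) = (P * s)%:C * (((Num.sqrt 2)^-1)%:C * (1 +i* 1)) * W.
  rewrite -es -cexp_real -cs -!cexpD; congr cexp.
  by apply: complexP; rewrite !ReImE /=; ring.
have e2 : cexp (- z0 ^+ 2) / (2 * z0) =
    (Num.sqrt pi / 2)%:C * ((s%:C * (1 +i* 1) * W) / z0).
  rewrite e1 PE (_ : Num.sqrt pi / 2 =
    Num.sqrt 2 * Num.sqrt pi * (Num.sqrt 2)^-1 * 2^-1); last first.
    by field; rewrite gt_eqF.
  have s2c : (Num.sqrt 2 : R)%:C != 0 by rewrite -normc_eq0 normc_real normr_eq0 gt_eqF.
  rewrite !rmorphM !fmorphV /= rmorph_nat; field.
  by rewrite z00 s2c.
have W1 : normc (1 - W) <= 2 * eta ^+ 2.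
  have -> : 2 * eta ^+ 2 = normc (0 +i* (2 * eta ^+ 2)) * 1.
    by rewrite mulr1 /= expr0n add0r sqrtr_sqr ger0_norm // mulr_ge0 ?sqr_ge0.
  by apply: normc_1Bcexp => t _; rewrite /= mulr0 expR0.
(* Relative to sqrt(pi)/2 <= 1 the defect is (z0 - s (1 + i) W) / z0. As |z0| >= sqrt 2 s, the phase
   error contributes at most 2 eta^2 and the displacement eta (-1 + i) at most eta / s. *)
have b1 : normc ((Num.sqrt pi / 2)%:C - cexp (- z0 ^+ 2) / (2 * z0)) <= 300^-1.
  rewrite e2 (_ : _ - _ = (Num.sqrt pi / 2)%:C *
    ((s%:C * (1 +i* 1) * (1 - W) + eta%:C * ((-1) +i* 1)) / z0)); last first.
    have -> : s%:C * (1 +i* 1) * (1 - W) + eta%:C * ((-1) +i* 1) =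
        z0 - s%:C * (1 +i* 1) * W.
      have -> : z0 = s%:C * (1 +i* 1) + eta%:C * ((-1) +i* 1).
        by apply: complexP; rewrite !ReImE /=; ring.
      by ring.
    by field.
  rewrite !ComplexField.Normc.normcM ComplexField.Normc.normcV normc_real.
  rewrite ger0_norm ?divr_ge0 // mulrA ler_pdivrMr ?normc_gt0 //.
  have one_i (c : R) : c ^+ 2 = 1 -> normc (c +i* 1) = Num.sqrt 2 :> R.
    by move=> /= ->; rewrite expr1n.
  have num : normc (s%:C * (1 +i* 1) * (1 - W) + eta%:C * ((-1) +i* 1)) <=
      s * Num.sqrt 2 * (2 * eta ^+ 2) + eta * Num.sqrt 2.
    apply: (le_trans (le_normcD _ _)); rewrite !ComplexField.Normc.normcM.
    rewrite !normc_real !one_i ?sqrrN ?expr1n // (ger0_norm (ltW s0)).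
    rewrite (ger0_norm (ltW eta0)).
    by rewrite lerD2r ler_wpM2l // mulr_ge0 ?(ltW s0) ?(ltW sqrt2_gt0).
  apply: (@le_trans _ _ (s * Num.sqrt 2 * (2 * eta ^+ 2) + eta * Num.sqrt 2)).
    apply: le_trans num; rewrite ler_piMl ?normc_ge0 // ler_pdivrMr // mul1r.
    exact: sqrtpi2.
  apply: (@le_trans _ _ (300^-1 * (Num.sqrt 2 * s))); last first.
    by apply: ler_wpM2l z0_ge; lra.
  rewrite -subr_ge0 [X in 0 <= X](_ : _ = Num.sqrt 2 *
    (300^-1 * s - s * (2 * eta ^+ 2) - eta)); last by ring.
  have eta2 : eta ^+ 2 <= 400^-1 * 400^-1 by rewrite expr2 ler_pM // ltW.
  have := ler_wpM2l (ltW s0) eta2.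
  move=> h; apply: mulr_ge0; first exact: ltW.
  by clear - h eta1 s100 eta0; lra.
(* The exponential in the vertical estimate equals exp(4 s eta) = P s, while the denominator is of
   order s^3. *)
have b2 : normc (gauss_corr z0 - gauss_corr (s - eta)%:C) <= 300^-1.
  apply: (le_trans (gauss_corr_vertical _ _)); [lra|lra|].
  rewrite (_ : (s + eta) ^+ 2 - _ = 4 * s * eta); last by ring.
  have x0 : 0 < s - eta by lra.
  have y0 : 0 < s + eta by lra.
  have x2 : 0 < (s - eta) ^+ 2 by rewrite exprn_gt0.
  rewrite es ler_pdivrMr; last by rewrite (mulr_gt0 _ y0) // mulr_gt0.
  have q1 : s ^+ 2 / 4 <= (s - eta) ^+ 2 by nra.
  have q2 : s ^+ 2 / 4 * s <= (s - eta) ^+ 2 * (s + eta).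
    apply: ler_pM q1 _; [|exact: ltW|lra].
    by have := sqr_ge0 s; lra.
  have q3 : 2000 * s <= s ^+ 2 * s.
    by apply: (ler_wpM2r (ltW s0)); have := mulr_ge0 (ltW s0) (ltW s0); nra.
  have q4 : P * s <= 3 * s by rewrite ler_wpM2r ?(ltW s0).
  lra.
(* Three errors of 1/300 each: the vertical move to the real axis, the real limit, and the defect of
   the leading-order equation. *)
have Gz0 : normc (gauss_prim z0) <= 100^-1.
  rewrite (_ : gauss_prim z0 = (gauss_corr z0 - gauss_corr (s - eta)%:C) +
    (gauss_corr (s - eta)%:C - (Num.sqrt pi / 2)%:C) +
    ((Num.sqrt pi / 2)%:C - cexp (- z0 ^+ 2) / (2 * z0))); last first.
    by rewrite {1}/gauss_corr; ring.
  apply: (le_trans (le_normcD _ _)).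
  by have := le_normcD (gauss_corr z0 - gauss_corr (s - eta)%:C)
    (gauss_corr (s - eta)%:C - (Num.sqrt pi / 2)%:C); lra.
(* The radius is of order 1/s because z^2 varies at rate about 2 |z0| <= 4 s. With 1/(80 s), z^2 -
   z0^2 stays below 1/8 in modulus on the disc, and the first Newton step is at most (1/2) (80 r) /
   100 <= r / 2. *)
have r0 : 0 < (80 * s)^-1 by rewrite invr_gt0 mulr_gt0.
have rs : (80 * s)^-1 * (80 * s) = 1 by rewrite mulVf // gt_eqF // mulr_gt0.
set r := (80 * s)^-1 in r0 rs.
have r_small : 2 * r <= 1 by nra.
have [z zz0 Gz] : exists2 z, normc (z - z0) <= 2 * r & gauss_prim z = 0.
  apply: gauss_prim_newton => //.
    move=> z zz0; rewrite -cexpD.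
    have -> : z0 ^+ 2 + - z ^+ 2 = - ((z - z0) * (2 * z0 + (z - z0))) by ring.
    set w := - (_ * _); have w8 : normc w <= 8^-1.
      rewrite normcN ComplexField.Normc.normcM.
      apply: (@le_trans _ _ (2 * r * (4 * s + 1))); last by nra.
      apply: ler_pM; rewrite ?normc_ge0 //.
      apply: (le_trans (le_normcD _ _)); rewrite ComplexField.Normc.normcM normc_nat.
      by lra.
    have e2' : expR 8^-1 <= 2 :> R.
      have := expR_ge1Dx (- 8^-1 : R); rewrite expRN => h.
      rewrite -[leRHS]invrK -[leLHS]invrK lef_pV2 ?posrE ?invr_gt0 ?expR_gt0 //; lra.
    apply: (@le_trans _ _ (normc w * 2)); last by lra.
    apply: normc_1Bcexp => t /andP[t0 t1]; apply: le_trans e2'; rewrite ler_expR.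
    apply: (le_trans (ler_norm _)); rewrite normrM ger0_norm //.
    apply: (@le_trans _ _ (normc w)) => //.
    by apply: le_trans (Re_le_normc w); rewrite ler_piMl.
  rewrite ComplexField.Normc.normcM normc_cexp.
  have -> : Re (z0 ^+ 2) = - (4 * s * eta) by rewrite ReX2 /=; ring.
  rewrite expRN es invfM.
  have Pinv : P^-1 <= 2^-1 by rewrite lef_pV2 ?posrE //; lra.
  have sinv : s^-1 = 80 * r by rewrite /r; field; rewrite gt_eqF.
  rewrite sinv; apply: (@le_trans _ _ (2^-1 * (80 * r) * 100^-1)); last by lra.
  have r80 : 0 <= 80 * r by lra.
  have Pinv0 : 0 <= P^-1 by rewrite invr_ge0; lra.
  have Pr := ler_wpM2r r80 Pinv.
  by apply: (ler_pM _ _ Pr Gz0); [exact: mulr_ge0|exact: normc_ge0].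
exists z => //; have := le_trans (Re_le_normc _) zz0.
by rewrite !ReImE /= ler_norml => /andP[]; lra.
Qed.

End Asymptotics.

(** * Choice of parameters, and zeros with arbitrarily large real part *)

Section Zeros.
Context {R : realType}.

(** The phase equation: - 2 s^2 must agree modulo 2 pi with pi/4, the argument of sqrt(pi) s (1 +
    i). *)
Lemma cexp_piquarter (s : R) (k : nat) : 2 * s ^+ 2 = pi *+ 2 *+ k - pi / 4 ->
  cexp (0 +i* (- (2 * s ^+ 2))) = ((Num.sqrt 2)^-1)%:C * (1 +i* 1).
Proof.
move=> ->.
have pi0 := pi_gt0 R.
have sc : sin (pi / 4) = cos (pi / 4) :> R.
  rewrite -cosBpihalf -cosN; congr cos; by field.
have c0 : 0 <= cos (pi / 4) :> R by apply: cos_ge0_pihalf; apply/andP; split; lra.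
have cE : cos (pi / 4) = (Num.sqrt 2)^-1 :> R.
  rewrite -[LHS]ger0_norm // -sqrtr_sqr -sqrtrV //; congr Num.sqrt.
  by have := cos2Dsin2 (pi / 4 : R); rewrite sc; lra.
have perc : cos (pi *+ 2 *+ k - pi / 4) = cos (pi / 4) :> R.
  by rewrite addrC (periodicn (@cosD2pi R)) cosN.
have pers : sin (pi *+ 2 *+ k - pi / 4) = - sin (pi / 4) :> R.
  by rewrite addrC (periodicn (@sinD2pi R)) sinN.
apply: complexP; rewrite !ReImE /= expR0 ?cosN ?sinN ?perc ?pers ?sc cE; ring.
Qed.

Lemma gauss_corr_real_near (e : R) : 0 < e -> exists A : R, forall x, A <= x ->
  normc (gauss_corr x%:C - (Num.sqrt pi / 2)%:C) <= e.
Proof.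
move=> e0; have [A GA] := cvg_gauss_prim_real (divr_gt0 e0 (ltr0Sn _ 1)).
exists (Num.max A e^-1) => x; rewrite ge_max => /andP[/GA xA xe].
have x0 : 0 < x by apply: lt_le_trans xe; rewrite invr_gt0.
have -> : gauss_corr x%:C - (Num.sqrt pi / 2)%:C =
    (gauss_prim x%:C - (Num.sqrt pi / 2)%:C) + cexp (- x%:C ^+ 2) / (2 * x%:C).
  by rewrite /gauss_corr; ring.
apply: (le_trans (le_normcD _ _)).
suff : normc (cexp (- x%:C ^+ 2) / (2 * x%:C)) <= e / 2 by lra.
rewrite ComplexField.Normc.normcM ComplexField.Normc.normcV.
rewrite ComplexField.Normc.normcM normc_nat normc_real gtr0_norm // invfM mulrA.
rewrite normc_cexp ReN ReX2 /= expr0n subr0.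
have xV : x^-1 <= e by rewrite -[leRHS]invrK lef_pV2 ?posrE ?invr_gt0.
have xV0 : 0 <= x^-1 by rewrite invr_ge0 ltW.
have ex1 : expR (- x ^+ 2) <= 1 by rewrite -expR0 ler_expR oppr_le0 sqr_ge0.
have ex0 := expR_ge0 (- x ^+ 2).
have := ler_pM ex0 xV0 ex1 xV; lra.
Qed.

Lemma gauss_prim_zeros (B : R) : exists2 z : R[i], B <= Re z & gauss_prim z = 0.
Proof.
have e0 : 0 < 300^-1 :> R by lra.
have [A corr_near] := gauss_corr_real_near e0.
(* A lower bound for s: [400 ^+ 2] forces eta <= 1/400, [A + 1] gives s - eta >= A, and [B + 2]
   covers the loss of 2 in the real part of the zero. *)
pose M : R := Num.max (400 ^+ 2) (Num.max (A + 1) (B + 2)).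
have M400 : 400 ^+ 2 <= M by rewrite le_max lexx.
have M0 : 0 <= M by apply: le_trans M400; exact: sqr_ge0.
have MA : A + 1 <= M by rewrite !le_max lexx orbT.
have MB : B + 2 <= M by rewrite !le_max lexx !orbT.
clearbody M.
pose k := (Num.bound (M ^+ 2)).+1.
have kM : M ^+ 2 <= k%:R - 1.
  by rewrite -natr1 addrK ltW // archi_boundP // sqr_ge0.
have k1 : 1 <= k%:R :> R by rewrite -[1]/(1%:R) ler_nat.
clearbody k.
have pi2 := pi_ge2 R; have pi4 : pi <= 4 :> R.
  have [/andP[_ h] _] := @pihalf_02_cos_pihalf R; lra.
have arg_ge : M ^+ 2 <= pi * k%:R - pi / 8.
  have := ler_wpM2r (le_trans ler01 k1) pi2; lra.
have arg0 := le_trans (sqr_ge0 M) arg_ge.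
pose s : R := Num.sqrt (pi * k%:R - pi / 8).
have s2 : s ^+ 2 = pi * k%:R - pi / 8 by rewrite sqr_sqrtr.
have Ms : M <= s by rewrite -(ger0_norm M0) -sqrtr_sqr ler_wsqrtr.
clearbody s.
have s400 := le_trans M400 Ms.
have s100 : 100 <= s by lra.
have s0 : 0 < s by lra.
have [P2 P3 _ _] := @sqrt_2pi_bounds R.
(* The modulus equation exp(4 s eta) = sqrt(2 pi) s, solved for L = 4 s eta. *)
pose L : R := ln (Num.sqrt (2 * pi) * s).
have Ps0 : 0 < Num.sqrt (2 * pi) * s by rewrite mulr_gt0 // (lt_le_trans _ P2).
have eL : expR L = Num.sqrt (2 * pi) * s by rewrite lnK // posrE.
have L0 : 0 < L.
  apply: ln_gt0; have := ler_wpM2r (ltW s0) P2; lra.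
have Pss := ler_wpM2r (ltW s0) P3.
(* From (1 + L/2)^2 <= exp(L) <= 3 s. The logarithm is thus at most of order sqrt s, which makes eta
   = L / (4 s) small. *)
have L2 : L ^+ 2 <= 12 * s.
  have e2 : expR L = expR (L / 2) ^+ 2 by rewrite -expRM_natr; congr expR; field.
  have e1 := expR_ge1Dx (L / 2).
  have : (1 + L / 2) ^+ 2 <= expR (L / 2) ^+ 2.
    rewrite ler_pXn2r // nnegrE ?expR_ge0 //; lra.
  rewrite -e2 eL; lra.
pose eta := L / (4 * s).
have eta0 : 0 < eta by rewrite divr_gt0 // mulr_gt0.
have etaE : 4 * s * eta = L by rewrite /eta; field; rewrite gt_eqF.
clearbody eta.
have eta400 : eta <= 400^-1.
  have : (4 * s) * (4 * s * eta ^+ 2) <= (4 * s) * 3.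
    have -> : 4 * s * (4 * s * eta ^+ 2) = L ^+ 2 by rewrite -etaE; ring.
    lra.
  rewrite ler_pM2l ?mulr_gt0 // => h.
  have := ler_wpM2r (sqr_ge0 eta) s400; have := sqr_ge0 (400 * eta - 1).
  by rewrite leNgt => sq h2; apply/negP => eta_gt; lra.
have eta1 : eta <= 1 by lra.
have [z sz Gz] : exists2 z : R[i], s - 2 <= Re z & gauss_prim z = 0.
  apply: (@gauss_prim_zero_near _ s eta) => //.
  - by rewrite eta0.
  - by rewrite etaE.
  - by apply: (@cexp_piquarter s k); rewrite s2 -mulr_natr; field.
  - by apply: corr_near; lra.
by exists z => //; lra.
Qed.

End Zeros.

(** * Linear independence *)

Section Independence.
Context {R : realType}.
Local Notation mu := (@lebesgue_measure R).

(** A nonzero value would persist on an open interval, of positive measure, inside the exceptional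
    null set. This turns independence modulo a.e. equality into pointwise evaluation. *)
Lemma ae_eq0_continuous (g : R -> R[i]) : ccontinuous g ->
  {ae @lebR R, forall x, g x = 0} -> forall x, g x = 0.
Proof.
move=> [gr gi] [N [mN N0 gN]] x0; apply/eqP; apply: contraPT N0 => gx0.
pose u x := Re (g x) ^+ 2 + Im (g x) ^+ 2.
have cu : continuous u.
  by move=> x; rewrite /u; under eq_fun do rewrite !expr2; apply: cvgD;
    apply: cvgM; solve [exact: gr|exact: gi].
have u0 : 0 < u x0 by rewrite /u -sqr_normcE exprn_gt0 // normc_gt0.
have /nbhs_ballP [d /= d0 du] : \forall x \near x0, 0 < u x.
  exact: (cvgr_gt _ (cu x0) _ u0).
have sub : `](x0 - d), (x0 + d)[%classic `<=` N.
  move=> x /=; rewrite in_itv /= => xd; apply: gN => /= gx.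
  have : 0 < u x.
    by apply: du; rewrite /ball /= distrC ltr_distl.
  by rewrite /u gx /= expr0n addr0 ltxx.
pose J : set R := `](x0 - d), (x0 + d)[%classic.
have : (mu J <= mu N)%E.
  apply: le_measure => //; rewrite inE; first exact: measurable_itv.
  exact: mN.
rewrite lebesgue_measure_itv /= lte_fin ltrBlDr -addrA ltrDl addr_gt0 //.
rewrite -EFinB => le_N N0; move: le_N; rewrite [mu N]N0 lee_fin.
by lra.
Qed.

Lemma vandermonde_inj (F : fieldType) (n : nat) (w x : 'I_n -> F) :
  injective w -> (forall m : 'I_n, \sum_(k < n) x k * w k ^+ m = 0) ->
  forall k, x k = 0.
Proof.
move=> w_inj sum0 k.
pose V := Vandermonde n (\row_j w j); pose X := \col_j x j.
have VX : V *m X = 0.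
  apply/matrixP => m j; rewrite !mxE -[RHS](sum0 m).
  by apply: eq_bigr => i _; rewrite !mxE mulrC.
have Vu : V \in unitmx.
  rewrite unitmxE unitfE det_Vandermonde.
  apply/prodf_neq0 => i _; apply/prodf_neq0 => j ij.
  by rewrite !mxE subr_eq0 (inj_eq w_inj) eq_sym neq_ltn ij.
have X0 : X = 0 by rewrite -[X](mulKmx Vu) VX mulmx0.
by have := congr1 (fun A : 'cV_n => A k 0) X0; rewrite !mxE.
Qed.

(** At integers the quadratic factor is the same for all means, and what depends on the mean is a
    geometric sequence in p. Hence the Vandermonde system. *)
Lemma fgauss_nat (m s2 om : R) (p : nat) : 0 < s2 ->
  fgauss m s2 om p%:R = (expR (- p%:R ^+ 2 / (2 * s2)))%:C *
    ((expR (- m ^+ 2 / (2 * s2)))%:C * cexp ((m / s2) +i* om) ^+ p).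
Proof.
move=> s20; rewrite -cexp_nat /fgauss -!cexp_real -!cexpD; congr cexp.
have pE : (p%:R : R[i]) = (p%:R : R)%:C by rewrite rmorph_nat.
rewrite pE; apply: complexP; rewrite !ReImE /=; last by ring.
by field; rewrite gt_eqF.
Qed.

Lemma fgauss_free (n : nat) (m om : 'I_n -> R) (s2 : R) (c : 'I_n -> R[i]) :
  0 < s2 -> injective m ->
  {ae @lebR R, forall x, \sum_(k < n) c k * fgauss (m k) s2 (om k) x = 0} ->
  forall k, c k = 0.
Proof.
move=> s20 m_inj ae0.
have all0 : forall x, \sum_(k < n) c k * fgauss (m k) s2 (om k) x = 0.
  apply: ae_eq0_continuous ae0; rewrite sum_funE; apply: big_ind => //.
  - exact: ccontinuous_cst.
  - exact: ccontinuousD.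
  - move=> k _; apply: ccontinuousM; first exact: ccontinuous_cst.
    exact: ccontinuous_fgauss.
pose d k := (expR (- m k ^+ 2 / (2 * s2)))%:C.
pose w k := cexp ((m k / s2) +i* om k).
have d0 k : d k != 0 by rewrite /d -cexp_real cexp_neq0.
(* The modulus of [w k] is exp(m k / s2), so distinct means separate the nodes whatever the
   frequencies. *)
have w_inj : injective w.
  move=> i j /(congr1 (@normc R)); rewrite !normc_cexp /= => /expR_inj.
  by move=> /(congr1 ( *%R^~ s2)); rewrite !divfK ?gt_eqF // => /m_inj.
have sum0 (p : 'I_n) : \sum_(k < n) (c k * d k) * w k ^+ p = 0.
  apply/eqP; rewrite -(mulrI_eq0 _ (mulfI (cexp_neq0 (- (p%:R : R) ^+ 2 / (2 * s2))%:C))).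
  rewrite cexp_real mulr_sumr -[X in _ == X](all0 p%:R); apply/eqP.
  by apply: eq_bigr => k _; rewrite fgauss_nat // /d /w; ring.
move=> k; have /eqP := vandermonde_inj w_inj sum0 k.
by rewrite mulf_eq0 (negbTE (d0 k)) orbF => /eqP.
Qed.

Lemma gauss_prim_zero_seq : exists z : nat -> R[i],
  (forall k, gauss_prim (z k) = 0) /\ injective (fun k => Re (z k)).
Proof.
pose Z B : R[i] := projT1 (cid2 (@gauss_prim_zeros R B)).
have ZB B : B <= Re (Z B) by rewrite /Z; case: cid2.
have Z0 B : gauss_prim (Z B) = 0 by rewrite /Z; case: cid2.
(* Each zero lies at least 1 to the right of the previous one, so the real parts increase
   strictly. *)
pose z k := iter k (fun w => Z (Re w + 1)) (Z 0).
exists z; split; first by case=> [|k]; exact: Z0.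
have mono : {homo (fun k => Re (z k)) : i j / (i < j)%N >-> i < j}.
  apply: homo_ltn => [y x t|k]; first exact: lt_trans.
  by apply: (@lt_le_trans _ _ (Re (z k) + 1)); [rewrite ltrDl|exact: ZB].
move=> i j /= zij; have [/mono|/mono|//] := ltngtP i j; by rewrite zij ltxx.
Qed.

Lemma nullT_infinite_dim (a : R) (n : nat) : 0 < a < 1 ->
  exists fs : 'I_n -> R -> R[i],
    (forall k, nullT a (fs k)) /\
    (forall c : 'I_n -> R[i],
      {ae @lebR R, forall x, \sum_(k < n) c k * fs k x = 0} ->
      forall k, c k = 0).
Proof.
move=> a01; have /andP[a0 a1] := a01.
have s20 : 0 < a / (1 - a) by rewrite divr_gt0 // subr_gt0.
have [z [z0 z_inj]] := gauss_prim_zero_seq.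
have p0 : 0 < Num.sqrt 2 :> R by rewrite sqrtr_gt0.
have q0 : 0 < Num.sqrt a by rewrite sqrtr_gt0.
(* [m] and [om] invert the affine map of the erf condition, sending (m k, om k) to exactly [z k];
   [m k] is a nonzero multiple of Re (z k), hence injective in k. *)
pose m (k : 'I_n) := Num.sqrt 2 * Num.sqrt a / (1 - a) * Re (z k).
pose om (k : 'I_n) := Num.sqrt 2 / Num.sqrt a * Im (z k).
have erf0 k : erf ((1 / Num.sqrt 2)%:C *
    (((1 - a) / Num.sqrt a * m k) +i* (Num.sqrt a * om k))) = 0.
  apply/erf_eq0; rewrite [X in gauss_prim X](_ : _ = z k) //.
  rewrite /m /om; move: (Num.sqrt 2) (Num.sqrt a) p0 q0 => p q p0 q0.
  by apply: complexP; rewrite !ReImE /=; field; rewrite ?subr_eq0 !gt_eqF.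
exists (fun k => fgauss (m k) (a / (1 - a)) (om k)); split.
  move=> k.
  have := @nullT_span R a 1 (fun=> m k) (fun=> om k) (fun=> 1) a01 (fun=> erf0 k).
  by under eq_fun do rewrite big_ord1 mul1r.
move=> c; apply: fgauss_free => // i j.
have cst0 : Num.sqrt 2 * Num.sqrt a / (1 - a) != 0.
  by rewrite !mulf_neq0 ?invr_neq0 ?gt_eqF // subr_gt0.
by move=> /(mulfI cst0) /z_inj /val_inj.
Qed.

End Independence.

Theorem theorem8 (R : realType) (a : R) (ha : 0 < a < 1) :
  (* N_{L^1}(T_a) is infinite-dimensional (as a subspace of L^1, i.e.
     modulo a.e. equality): for each n it contains n linearly independent
     elements *)
  (forall n : nat, exists fs : 'I_n -> R -> R[i],
      (forall k, nullT a (fs k)) /\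
      (forall c : 'I_n -> R[i],
          {ae @lebR R, forall x, \sum_(k < n) c k * fs k x = 0} ->
          forall k, c k = 0)) /\
  (* span of the f_{mu_n, a/(1-a), omega_n} with erf-zero condition lies in it *)
  (forall (n : nat) (mu om : 'I_n -> R) (c : 'I_n -> R[i]),
      (forall k, erf ((1 / Num.sqrt 2)%:C *
                      (((1 - a) / Num.sqrt a * mu k) +i* (Num.sqrt a * om k))) = 0) ->
      nullT a (fun x => \sum_(k < n) c k * fgauss (mu k) (a / (1 - a)) (om k) x)).
Proof.
split=> [n|n mu om c zk]; first exact: nullT_infinite_dim.
exact: nullT_span.
Qed.
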